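(* Let $E$ be a Banach space, let $A_1,A_2$ be generators of strongly continuous semigroups $(T_1(t))_{t\ge0}$, $(T_2(t))_{t\ge0}$ on $E$, let $F=\mathrm{C}_0(\mathbb{R}_+;E)$, and on $\mathcal{E}=E\times F\times F$ let $$\mathcal{A}_1=\begin{pmatrix}A_1&\delta_0&0\\0&\frac{\mathrm d}{\mathrm ds}&0\\0&0&0\end{pmatrix},\ D(\mathcal{A}_1)=D(A_1)\times D(\tfrac{\mathrm d}{\mathrm ds})\times F,\qquad \mathcal{A}_2=\begin{pmatrix}A_2&0&\delta_0\\0&0&0\\0&0&\frac{\mathrm d}{\mathrm ds}\end{pmatrix},\ D(\mathcal{A}_2)=D(A_2)\times F\times D(\tfrac{\mathrm d}{\mathrm ds}),$$ with $D(\frac{\mathrm d}{\mathrm ds})=\mathrm{C}_0^1(\mathbb{R}_+;E)$, and let $(\mathcal{T}_1(t))_{t\ge0}$, $(\mathcal{T}_2(t))_{t\ge0}$ be the strongly continuous semigroups generated by $\mathcal{A}_1,\mathcal{A}_2$. Suppose that for some $M'\ge1$ and $\omega'\ge0$ one has $$\bigl\|\tfrac1{2^n}(T_1(\tfrac tn)T_2(\tfrac tn)+T_2(\tfrac tn)T_1(\tfrac tn))^n\bigr\|\le M'\mathrm{e}^{t\omega'}\quad\text{for all }t\ge0\text{ and }n\in\mathbb{N}.$$ Then there exist $M\ge1$ and $\omega\in\mathbb{R}$ such that $$\Bigl\|\frac1{2^n}\bigl(\mathcal{T}_1(\tfrac tn)\mathcal{T}_2(\tfrac tn)+\mathcal{T}_2(\tfrac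 tn)\mathcal{T}_1(\tfrac tn)\bigr)^n\Bigr\|\le M\mathrm{e}^{t\omega}\quad\text{for all }t\ge0\text{ and }n\in\mathbb{N}.$$ Moreover, if $\mathcal{A}:=\overline{\mathcal{A}_1+\mathcal{A}_2}$ is the generator of a strongly continuous semigroup $(\mathcal{T}(t))_{t\ge0}$ on $\mathcal{E}$, then for all $x\in\mathcal{E}$ and $t\ge0$ $$\mathcal{T}(t)x=\lim_{n\to\infty}\frac1{2^n}\bigl(\mathcal{T}_1(\tfrac tn)\mathcal{T}_2(\tfrac tn)+\mathcal{T}_2(\tfrac tn)\mathcal{T}_1(\tfrac tn)\bigr)^nx.$$
   Context: $\mathrm{C}_0(\mathbb{R}_+;E)$ is the space of continuous $E$-valued functions on $\mathbb{R}_+=[0,\infty)$ vanishing at infinity, with the supremum norm; $\frac{\mathrm d}{\mathrm ds}$ with domain $\mathrm{C}^1_0(\mathbb{R}_+;E)=\{f\in \mathrm{C}_0(\mathbb{R}_+;E): f\in \mathrm{C}^1,\ f'\in \mathrm{C}_0(\mathbb{R}_+;E)\}$ is the generator of the left-shift semigroup $(L(t)f)(s)=f(s+t)$ on $F$; $\delta_0f:=f(0)$ is point evaluation at $0$. The operators $\mathcal{A}_1,\mathcal{A}_2$ do generate strongly continuous semigroups on $\mathcal{E}$. $\overline{\mathcal{A}_1+\mathcal{A}_2}$ is the closure of the sum defined on $D(\mathcal{A}_1)\cap D(\mathcal{A}_2)$. $\mathbb{N}=\{1,2,\dots\}$. *)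

(* Defs.v *)
From HB Require Import structures.
From mathcomp Require Import all_boot all_order all_algebra ring.
From mathcomp Require Import all_classical all_reals all_analysis.

Set Implicit Arguments.
Unset Strict Implicit.
Unset Printing Implicit Defensive.

Import Order.TTheory GRing.Theory Num.Theory.
Import numFieldNormedType.Exports.

Local Open Scope classical_set_scope.
Local Open Scope ring_scope.

(* As a type, [Rplus R] carries the topology induced by [R]. *)
Definition Rplus (R : realType) : set R := [set s | 0 <= s].
Arguments Rplus : clear implicits.

Lemma Rplus_clamp_subproof (R : realType) (r : R) :
  Num.max 0 r \in @Rplus R.
Proof. by rewrite inE /Rplus /= le_max lexx. Qed.

Definition Rplus_clamp (R : realType) (r : R) : Rplus R :=
  exist _ (Num.max 0 r) (Rplus_clamp_subproof r).

Definition Rplus0 (R : realType) : Rplus R := Rplus_clamp 0.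

Lemma Rplus_clampK (R : realType) (s : Rplus R) : Rplus_clamp (\val s) = s.
Proof.
apply: val_inj => /=; apply/max_idPr.
by have := valP s; rewrite inE.
Qed.

Lemma continuous_Rplus_clamp (R : realType) : continuous (@Rplus_clamp R).
Proof.
apply: continuous_comp_initial => r /=.
by apply: (@continuous_max R R (cst 0) id); [exact: cst_continuous|].
Qed.

Section C0.
Context {R : realType} {E : completeNormedModType R}.
Implicit Types f g : Rplus R -> E.

Definition vanishes_at_infinity f :=
  forall e : R, 0 < e -> exists a : R, forall s, a <= \val s -> `|f s| <= e.

Definition C0_pred : {pred Rplus R -> E} :=
  mem [set f : Rplus R -> E | continuous f /\ vanishes_at_infinity f].

Lemma C0_submod_closed : submod_closed C0_pred.
Proof.
split.
  rewrite inE; split; first by move=> s; exact: cst_continuous.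
  by move=> e e0; exists 0 => s _; rewrite normr0 ltW.
move=> a f g; rewrite !inE => -[cf vf] [cg vg]; split.
  move=> s; have cafs : a *: f t @[t --> s] --> a *: f s.
    exact: (@cvgZ _ _ _ _ _ (fun=> a) f _ _ (cvg_cst _) (cf s)).
  exact: cvgD cafs (cg s).
move=> e e0.
have e20 : 0 < e / 2 by rewrite divr_gt0.
have ha : 0 < `|a| + 1 by rewrite ltr_wpDl.
have [M HM] := vf (e / 2 / (`|a| + 1)) (divr_gt0 e20 ha).
have [N HN] := vg (e / 2) e20.
exists (Num.max M N) => s; rewrite ge_max => /andP[Ms Ns].
rewrite (le_trans (ler_normD _ _))// [leRHS]splitr lerD ?HN//.
rewrite normrZ (@le_trans _ _ ((`|a| + 1) * `|f s|)) ?ler_wpM2r ?lerDl//.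
by rewrite mulrC -ler_pdivlMr// HM.
Qed.

HB.instance Definition _ :=
  GRing.isSubmodClosed.Build R (Rplus R -> E) C0_pred C0_submod_closed.

End C0.
Arguments C0_pred : clear implicits.

Record C0 (R : realType) (E : completeNormedModType R) := MkC0 {
  C0_fun :> Rplus R -> E ;
  _ : C0_fun \in C0_pred R E }.
Arguments C0 : clear implicits.

Section C0_normed.
Context {R : realType} {E : completeNormedModType R}.
Implicit Types f g : C0 R E.

HB.instance Definition _ := [isSub for @C0_fun R E].
HB.instance Definition _ := [Choice of C0 R E by <:].
HB.instance Definition _ := [SubChoice_isSubLmodule of C0 R E by <:].

Lemma C0_continuous f : continuous f.
Proof. by have := valP f; rewrite inE => -[]. Qed.

Lemma C0_vanishes f : vanishes_at_infinity f.
Proof. by have := valP f; rewrite inE => -[]. Qed.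

Definition sup_norm f : R := sup (range (fun s => `|f s|)).

Lemma C0_has_sup f : has_sup (range (fun s => `|f s|)).
Proof.
split; first by exists `|f (Rplus0 R)|; exists (Rplus0 R).
have [a Ha] := C0_vanishes f ltr01.
have cfc : continuous (fun r : R => f (Rplus_clamp r)).
  move=> r; apply: continuous_comp; first exact: continuous_Rplus_clamp.
  exact: C0_continuous.
have /compact_bounded [M [_ HM]] : compact ((f \o @Rplus_clamp R) @` `[0, a]).
  apply: continuous_compact; last exact: segment_compact.
  exact: continuous_subspaceT.
exists (Num.max 1 (M + 1)) => _ [s _ <-]; rewrite le_max.
have [/Ha -> //|sa] := leP a (\val s).
apply/orP; right; apply: (HM (M + 1)); first by rewrite ltrDl.
exists (\val s); last by rewrite /= Rplus_clampK.
by rewrite /= in_itv /= (ltW sa) andbT; have := valP s; rewrite inE.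
Qed.

Lemma le_sup_norm f s : `|f s| <= sup_norm f.
Proof. by apply: ub_le_sup; [have [] := C0_has_sup f|exists s]. Qed.

Lemma sup_norm_le f (e : R) : (forall s, `|f s| <= e) -> sup_norm f <= e.
Proof.
move=> fe; apply: ge_sup; first by have [] := C0_has_sup f.
by move=> _ [s _ <-].
Qed.

Let sup_norm_ge0 f : 0 <= sup_norm f.
Proof. exact: le_trans (normr_ge0 _) (le_sup_norm f (Rplus0 R)). Qed.

Let sup_normD f g : sup_norm (f + g) <= sup_norm f + sup_norm g.
Proof.
apply: sup_norm_le => s; rewrite (le_trans (ler_normD _ _))//.
by rewrite lerD// le_sup_norm.
Qed.

Let sup_normZ_le (l : R) f : sup_norm (l *: f) <= `|l| * sup_norm f.
Proof.
by apply: sup_norm_le => s; rewrite normrZ ler_wpM2l// le_sup_norm.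
Qed.

Let sup_normZ (l : R) f : sup_norm (l *: f) = `|l| * sup_norm f.
Proof.
apply/eqP; rewrite eq_le sup_normZ_le/=.
have [->|l0] := eqVneq l 0; first by rewrite normr0 mul0r.
rewrite -ler_pdivlMl ?normr_gt0//.
by rewrite -[f in leLHS]scale1r -(mulVf l0) -scalerA -normfV sup_normZ_le.
Qed.

Let sup_norm0_eq0 f : sup_norm f = 0 -> f = 0.
Proof.
move=> f0; apply: val_inj; apply/funext => s /=.
by apply/eqP; rewrite -normr_le0 -f0 le_sup_norm.
Qed.

HB.instance Definition _ := Lmodule_isNormed.Build R (C0 R E)
  sup_normD sup_normZ sup_norm0_eq0.

Lemma C0_normE f : `|f| = sup_norm f.
Proof. by []. Qed.

Lemma C0_complete (F : set_system (C0 R E)) :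
  ProperFilter F -> cauchy F -> cvg F.
Proof.
move=> FF Fc.
have Fcp : forall e : R, 0 < e -> exists f : C0 R E, F (ball f e).
  by by move: Fc => /cauchyP Fc e /Fc.
have evc s : cvg ((fun f : C0 R E => f s) @ F).
  apply: cauchy_cvg; apply: cauchy_exP => e e0.
  have [f Ff] := Fcp _ e0; exists (f s).
  suff: F [set g : C0 R E | ball (f s) e (g s)] by [].
  apply: filterS Ff => g; rewrite -!ball_normE /ball_ /= => fg.
  exact: le_lt_trans (le_sup_norm (f - g) s) fg.
pose l s : E := lim ((fun f : C0 R E => f s) @ F).
have unif (e : R) : 0 < e -> F [set f : C0 R E | forall s, `|l s - f s| <= e].
  move=> e0; have e20 : 0 < e / 2 by rewrite divr_gt0.
  have [f0 Ff0] := Fcp _ e20.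
  apply: filterS (Ff0) => f; rewrite -ball_normE /ball_ /= => f0f s.
  rewrite -(subrKA (f0 s)) (le_trans (ler_normD _ _))// [leRHS]splitr lerD//.
  - apply/ler_addgt0Pl => d d0.
    have ld : F [set g : C0 R E | `|l s - g s| <= d].
      by have /cvgrPdist_le/(_ _ d0) := evc s.
    have [g [lg]] := filter_ex (filterI ld Ff0).
    rewrite -ball_normE /ball_ /= => f0g.
    rewrite -(subrKA (g s)) (le_trans (ler_normD _ _))// lerD// distrC ltW//.
    exact: le_lt_trans (le_sup_norm (f0 - g) s) f0g.
  - by rewrite ltW// (le_lt_trans (le_sup_norm (f0 - f) s) f0f).
have lP : l \in C0_pred R E.
  rewrite inE; split.
    move=> s; apply/(@cvgrPdist_le _ _ _ _ (nbhs_filter s)) => e e0.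
    have e30 : 0 < e / 3 by rewrite divr_gt0.
    have [f fl] := filter_ex (unif _ e30).
    have := @C0_continuous f s.
    move=> /(@cvgrPdist_le _ _ _ _ (nbhs_filter s))/(_ _ e30).
    apply: filterS => t ft.
    rewrite -(subrKA (f s)) (le_trans (ler_normD _ _))//.
    rewrite -(subrKA (f t) (f s)) (_ : e = e / 3 + (e / 3 + e / 3)); last first.
      by field.
    rewrite lerD// (le_trans (ler_normD _ _))// lerD//.
    by rewrite distrC.
  move=> e e0; have e20 : 0 < e / 2 by rewrite divr_gt0.
  have [f fl] := filter_ex (unif _ e20).
  have [a Ha] := C0_vanishes f e20; exists a => s /Ha fs.
  rewrite -(subrK (f s) (l s)) (le_trans (ler_normD _ _))//.
  by rewrite [leRHS]splitr lerD.
apply/cvg_ex; exists (MkC0 lP); apply/cvgrPdist_le => e e0.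
by apply: filterS (unif _ e0) => f fl; exact: sup_norm_le.
Qed.

HB.instance Definition _ := Uniform_isComplete.Build (C0 R E) C0_complete.

End C0_normed.
Arguments C0_continuous {R E} f x.

Section C01.
Context {R : realType} {E : completeNormedModType R}.
Implicit Types f g : C0 R E.

(* [s^'] is the punctured neighbourhood filter of [s] inside [Rplus R]: the
   derivative is two-sided for [s > 0] and from the right at [s = 0]. *)
Definition has_derivative f (f' : Rplus R -> E) :=
  forall s : Rplus R,
    (\val t - \val s)^-1 *: (f t - f s) @[t --> s^'] --> f' s.

Definition C01 : set (C0 R E) := [set f | exists g, has_derivative f g].

(* The value [0] outside [C01] is irrelevant. *)
Definition deriv_C0 f : C0 R E := xget 0 [set g : C0 R E | has_derivative f g].

Lemma Rplus_dnbhs_proper (s : Rplus R) : ProperFilter s^'.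
Proof.
split; last exact: dnbhs_filter.
rewrite /dnbhs /within /= => Us.
have : \forall r \near (\val s)^'+, Rplus_clamp r <> s.
  near=> r => /(congr1 val) /= rs.
  have : \val s < r by near: r; exact: nbhs_right_gt.
  have s0 : 0 <= \val s by have := valP s; rewrite inE.
  move=> sr; move: rs; rewrite max_r; first by move=> rs; move: sr; rewrite rs ltxx.
  exact: le_trans s0 (ltW sr).
have cs : Rplus_clamp r @[r --> \val s] --> s.
  by rewrite -[X in _ --> X]Rplus_clampK; exact: continuous_Rplus_clamp.
have : \forall r \near (\val s)^'+, Rplus_clamp r = s.
  apply: cvg_within; apply: (cs [set t | t = s]).
  by apply: filterS Us => t /= ts; apply: contrapT => /eqP /ts.
move=> rs ns; apply: (@filter_not_empty _ ((\val s)^'+)).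
by apply: filterS2 ns rs => r nrs /nrs.
Unshelve. all: by end_near. Qed.

Lemma deriv_C0E f g : has_derivative f g -> deriv_C0 f = g.
Proof.
move=> fg; apply: xget_unique; first exact: fg.
move=> g' fg'; apply: val_inj; apply/funext => s.
have PF := Rplus_dnbhs_proper s.
exact: (cvg_unique (@norm_hausdorff _ _) (fg' s) (fg s)).
Qed.

End C01.

(* A possibly unbounded operator: only the values of [act] on [dom] matter. *)
Record operator (X : Type) := Operator { dom : set X ; act : X -> X }.

Section operators.
Context {R : realType} {X : normedModType R}.
Implicit Types (A B : operator X) (S : X -> X) (T : R -> X -> X).

Definition graph A : set (X * X) := [set u | dom A u.1 /\ u.2 = act A u.1].

Definition operator_add A B : operator X :=
  Operator (dom A `&` dom B) (fun x => act A x + act B x).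

Definition is_closure A B := graph A = closure (graph B).

Definition opnorm S : \bar R :=
  ereal_sup [set (`|S x|)%:E | x in [set x : X | `|x| <= 1]].

(* Only the values [T t] with [0 <= t] matter. *)
Record strongly_continuous_semigroup T : Prop := {
  semigroup_linear : forall t, 0 <= t -> linear (T t) ;
  semigroup_bounded : forall t, 0 <= t -> continuous (T t) ;
  semigroup0 : forall x, T 0 x = x ;
  semigroupD : forall s t x, 0 <= s -> 0 <= t -> T (s + t) x = T s (T t x) ;
  semigroup_orbit :
    forall x, {within Rplus R, continuous (fun t => T t x)} }.

Definition diff_quotient T (x : X) (h : R) : X := h^-1 *: (T h x - x).

Definition is_generator A T :=
  dom A = [set x | cvg (diff_quotient T x h @[h --> 0^'+])] /\
  forall x, dom A x -> diff_quotient T x h @[h --> 0^'+] --> act A x.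

Definition generates A T :=
  strongly_continuous_semigroup T /\ is_generator A T.

Definition symmetrized_product (T1 T2 : R -> X -> X) (t : R) (n : nat) (x : X) :=
  let h := t / n%:R in
  2 ^- n *: iter n (fun y => T1 h (T2 h y) + T2 h (T1 h y)) x.

End operators.

Section block_operators.
Context {R : realType} {E : completeNormedModType R}.

Definition delta0 (f : C0 R E) : E := f (Rplus0 R).

Definition block_operator1 (A : operator E) : operator (E * C0 R E * C0 R E) :=
  Operator
    [set u | dom A u.1.1 /\ C01 u.1.2]
    (fun u => (act A u.1.1 + delta0 u.1.2, deriv_C0 u.1.2, 0)).

Definition block_operator2 (A : operator E) : operator (E * C0 R E * C0 R E) :=
  Operator
    [set u | dom A u.1.1 /\ C01 u.2]
    (fun u => (act A u.1.1 + delta0 u.2, 0, deriv_C0 u.2)).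

End block_operators.

(* Main.v *)
Require Import Defs.
From mathcomp Require Import all_boot all_order all_algebra ring lra.
From mathcomp Require Import all_classical all_reals all_analysis.

Set Implicit Arguments.
Unset Strict Implicit.
Unset Printing Implicit Defensive.

Import Order.TTheory GRing.Theory Num.Theory.
Import numFieldNormedType.Exports.

Local Open Scope classical_set_scope.
Local Open Scope ring_scope.

(** The generators are lower triangular in the splitting of the product space
    into the [E] component and the two function components, and so are the
    semigroups: for [i = 1, 2] the semigroup [cTi] does not increase the norms
    of the function components, and the [E] component of [cTi t (x, f, g)]
    differs from [Ti t x] by at most [t K e^(ct)] times the norm of [(f, g)]
    (informally, by the integral of [Ti (t - s)] applied to the driving function
    component at [s], over [0 <= s <= t]).  To see
    this for [i = 1] and [u = (x, f, g)] in the domain, one differentiates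
    [r |-> (second component of cT1 r u)(q + t - r)], which is constant, and
    [s |-> T1 (t - s) (E component of cT1 s u)], whose right derivative is
    [T1 (t - s) (f s)], and applies a mean value inequality for right
    derivatives ([shift_component], [driven_component]); then one passes to the
    closure of the domain.

    Stability ([symmetrized_stability]): put [h = t / n], let [W h] be half the
    sum of the two products on [E] and [V h] the same average on the product
    space.  The [E] component of [V h u] is [W h] of the [E] component of [u] up
    to an error of order [h] times the norm of the function components, which
    [V h] does not increase.  Summing these [n] errors, each propagated by a
    power of the stable [W h], gives an error of order [n h = t], and
    [t <= e^t].

    Convergence ([product_formula]): for [x] in the domain of the generator, the
    orbit [y s = cT s x] satisfies [y' = A y], but its values need not lie in the
    core on which [V h] is consistent.  However [(y s, A (y s))] lies in the
    closure of the graph of the sum; interpolating linearly finitely many core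
    vectors, chosen near [y (j tau)] in the graph norm, with an accuracy
    [e tau] that survives division by the step [tau], gives a core-valued curve
    [u] with [V h (u a) - u (a + h)] of size [e h] ([approximate_solution]).
    Stability turns this local defect into [V h ^ n (u 0) - u t] of size [e t].
    A density argument finishes the proof.

    Density of the domain of a generator ([dom_generator_dense]) rests on
    primitives of continuous vector-valued functions, constructed in
    [exists_primitive] as limits of polygons with Riemann sums as nodes; the
    exponential growth bound ([semigroup_growth]) rests on the Banach-Steinhaus
    theorem. *)

(** * Identities between linear combinations of vectors *)

Section linear_expressions.
Context {R : realType} {X : lmodType R}.

(** Syntax for linear combinations of the vectors of a list, the index of a
    [LinVar] being its position there; it reduces a vector identity to finitely
    many scalar ones. *)
Inductive lin_expr :=
| LinVar of nat
| LinZero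
| LinAdd of lin_expr & lin_expr
| LinOpp of lin_expr
| LinScale of R & lin_expr.

Fixpoint lin_eval (xs : seq X) (t : lin_expr) : X :=
  match t with
  | LinVar i => xs`_i
  | LinZero => 0
  | LinAdd t1 t2 => lin_eval xs t1 + lin_eval xs t2
  | LinOpp t1 => - lin_eval xs t1
  | LinScale a t1 => a *: lin_eval xs t1
  end.

Fixpoint lin_coef (t : lin_expr) (i : nat) : R :=
  match t with
  | LinVar j => (if Nat.eqb i j then 1 else 0)
  | LinZero => 0
  | LinAdd t1 t2 => lin_coef t1 i + lin_coef t2 i
  | LinOpp t1 => - lin_coef t1 i
  | LinScale a t1 => a * lin_coef t1 i
  end.

Lemma lin_eval_coef (xs : seq X) (t : lin_expr) :
  lin_eval xs t = \sum_(i < size xs) lin_coef t i *: xs`_i.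
Proof.
elim: t => [j||t1 IH1 t2 IH2|t IH|a t IH] /=.
- have [jn|nj] := ltnP j (size xs).
    rewrite (bigD1 (Ordinal jn))//= PeanoNat.Nat.eqb_refl scale1r big1 ?addr0//.
    move=> i ij; case: PeanoNat.Nat.eqb_spec => [e|_]; last by rewrite scale0r.
    by move: ij; rewrite -val_eqE /= e eqxx.
  rewrite nth_default// big1// => i _.
  case: PeanoNat.Nat.eqb_spec => [e|_]; last by rewrite scale0r.
  by have := ltn_ord i; rewrite [X in (X < _)%N]e ltnNge nj.
- by rewrite big1// => i _; rewrite scale0r.
- by rewrite IH1 IH2 -big_split/=; apply: eq_bigr => i _; rewrite scalerDl.
- by rewrite IH -sumrN; apply: eq_bigr => i _; rewrite scaleNr.
- by rewrite IH scaler_sumr; apply: eq_bigr => i _; rewrite scalerA.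
Qed.

Lemma lin_expr_eq (xs : seq X) (t1 t2 : lin_expr) :
  foldr and True [seq lin_coef t1 i = lin_coef t2 i | i <- iota 0 (size xs)] ->
  lin_eval xs t1 = lin_eval xs t2.
Proof.
move=> H; rewrite !lin_eval_coef; apply: eq_bigr => i _; congr (_ *: _).
have : (i : nat) \in iota 0 (size xs) by rewrite mem_iota ltn_ord.
elim: (iota _ _) H => //= j s IH [Hj /IH Hs]; rewrite inE => /orP[/eqP->//|].
exact: Hs.
Qed.

End linear_expressions.

Ltac lin_index x xs :=
  lazymatch xs with
  | x :: _ => constr:(0%N)
  | _ :: ?ys => let n := lin_index x ys in constr:(S n)
  end.

Ltac lin_add_var x xs :=
  match xs with
  | _ => let n := lin_index x xs in xs
  | _ => constr:(x :: xs)
  end.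

Ltac lin_vars t xs :=
  lazymatch t with
  | 0 => xs
  | ?a + ?b => let ys := lin_vars a xs in lin_vars b ys
  | - ?a => lin_vars a xs
  | _ *: ?a => lin_vars a xs
  | ?x => lin_add_var x xs
  end.

Ltac lin_reify R t xs :=
  lazymatch t with
  | 0 => constr:(@LinZero R)
  | ?a + ?b => let a' := lin_reify R a xs in
      let b' := lin_reify R b xs in constr:(@LinAdd R a' b')
  | - ?a => let a' := lin_reify R a xs in constr:(@LinOpp R a')
  | ?c *: ?a => let a' := lin_reify R a xs in constr:(@LinScale R c a')
  | ?x => let n := lin_index x xs in constr:(@LinVar R n)
  end.

(** Closes an identity between linear combinations of vectors by comparing the
    scalar coefficients, each comparison being a field identity. *)
Ltac linear_comb :=
  lazymatch goal with
  | |- @eq ?X ?l ?r =>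
    let nil_X := constr:(@nil X) in
    let ys := lin_vars l nil_X in
    let xs := lin_vars r ys in
    let R := lazymatch goal with R : realType |- _ => R end in
    let l' := lin_reify R l xs in
    let r' := lin_reify R r xs in
    apply: (@lin_expr_eq R _ xs l' r'); simpl; repeat split; try (by field)
  end.

(** * Mean value inequality and uniform continuity on a segment *)

Section calculus.
Context {R : realType}.

(** Induction along a segment: the supremum of the points where [P] holds is
    itself a point approached from the left by such points, so the step extends
    [P] beyond it unless it is already [b]. *)
Lemma real_induction (a b : R) (P : R -> Prop) : a <= b -> P a ->
  (forall c : R, a <= c <= b ->
    (forall d : R, 0 < d -> exists r : R, [/\ a <= r <= b, c - d <= r <= c & P r]) ->
    exists2 d : R, 0 < d & forall s : R, c <= s <= c + d -> s <= b -> P s) ->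
  P b.
Proof.
move=> ab Pa step; pose S := [set c | a <= c <= b /\ P c].
have supS : has_sup S.
  split; first by exists a; split => //; rewrite lexx.
  by exists b => c [/andP[]].
have aS : a <= sup S by apply: (ub_le_sup (proj2 supS)); split => //; rewrite lexx.
have Sb : sup S <= b by apply: (ge_sup (proj1 supS)) => c [/andP[]].
have [||d d0 Pd] := step (sup S); first by rewrite aS.
  move=> d d0; have [r [/andP[ar rb] Pr] dr] := sup_adherent d0 supS.
  exists r; split=> //; first by rewrite ar.
  rewrite (ltW dr)/=; apply: (ub_le_sup (proj2 supS)).
  by split => //; rewrite ar.
have [bS|Sltb] := leP b (sup S); first by apply: Pd => //; lra.
have m1 : Num.min b (sup S + d) <= b by rewrite ge_min lexx.
have m2 : Num.min b (sup S + d) <= sup S + d by rewrite ge_min lexx orbT.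
have m3 : sup S < Num.min b (sup S + d) by rewrite lt_min Sltb; lra.
have : Num.min b (sup S + d) <= sup S.
  apply: (ub_le_sup (proj2 supS)); split; first lra.
  by apply: Pd => //; lra.
lra.
Qed.

Lemma mul_div_succ_le (a e : R) : 0 <= a -> 0 <= e -> a * (e / (a + 1)) <= e.
Proof. by move=> a0 e0; rewrite mulrCA ler_piMr// ler_pdivrMr; lra. Qed.

Context {X : normedModType R}.
Implicit Types (f u : R -> X) (x y v : X).

Definition continuous_between (a b : R) f := forall s : R, a <= s <= b ->
  forall e : R, 0 < e -> exists2 d : R, 0 < d &
    forall r : R, a <= r <= b -> `|r - s| <= d -> `|f r - f s| <= e.

(** The upper right derivative of [f] at [s] has norm at most [K]; the endpoint
    [b] keeps the increments inside the segment. *)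
Definition right_lipschitz_at (K b s : R) f := forall e : R, 0 < e ->
  exists2 d : R, 0 < d &
    forall h : R, 0 < h <= d -> s + h <= b -> `|f (s + h) - f s| <= (K + e) * h.

(** Only right derivatives are at hand for semigroup orbits.  For each [e], the
    bound with slope [K + e] passes to limits from the left by continuity and
    extends to the right by the bound on right difference quotients. *)
Lemma mean_value_inequality (a b K : R) f : a <= b -> 0 <= K ->
  continuous_between a b f ->
  (forall s : R, a <= s < b -> right_lipschitz_at K b s f) ->
  `|f b - f a| <= K * (b - a).
Proof.
move=> ab K0 cf lf; apply/ler_addgt0Pl => e0 e00.
pose e := e0 / (b - a + 1).
have e_gt0 : 0 < e by apply: divr_gt0 => //; lra.
apply: (@le_trans _ _ ((K + e) * (b - a))); last first.
  have -> : e0 = e * (b - a + 1) by rewrite /e divfK//; lra.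
  nra.
apply: (@real_induction a b (fun c : R => `|f c - f a| <= (K + e) * (c - a))) => //.
  by rewrite !subrr normr0 mulr0.
move=> c acb Pc.
have {}Pc : `|f c - f a| <= (K + e) * (c - a).
  apply/ler_addgt0Pl => e' e'0.
  have [d d0 fd] := cf c acb e' e'0.
  have [r [arb rc Pr]] := Pc d d0.
  have := ler_distD (f r) (f c) (f a).
  have fr : `|f r - f c| <= e' by apply: fd => //; rewrite ler_norml; lra.
  rewrite (distrC (f c) (f r)).
  have : (K + e) * (r - a) <= (K + e) * (c - a) by rewrite ler_wpM2l; lra.
  lra.
have [cb|bc] := ltP c b; last first.
  by exists 1 => // s cs sb; have -> : s = c by lra.
have [|d d0 fd] := lf c _ e e_gt0; first lra.
exists d => // s cs sb.
have [->//|sc] := eqVneq s c.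
have := fd (s - c); rewrite (addrC c) subrK => /(_ _ sb).
have -> : 0 < s - c <= d.
  have : c < s by rewrite lt_neqAle eq_sym sc; lra.
  lra.
move=> /(_ isT) H; have := ler_distD (f c) (f s) (f a); lra.
Qed.

(** The largest initial segment on which [f] has a modulus of continuity for
    [e] is extended past its end [c]: two close points either lie both in the
    part already treated, or both near [c]. *)
Lemma continuous_between_uniform (a b : R) f : a <= b ->
  continuous_between a b f -> forall e : R, 0 < e -> exists2 d : R, 0 < d &
    forall r s : R, a <= r <= b -> a <= s <= b -> `|r - s| <= d ->
      `|f r - f s| <= e.
Proof.
move=> ab cf e e0.
apply: (@real_induction a b (fun c : R => exists2 d : R, 0 < d & forall r s,
    a <= r <= c -> a <= s <= c -> `|r - s| <= d -> `|f r - f s| <= e)) => //.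
  exists 1 => [|r s ra sa _]; first exact: ltr01.
  have -> : r = a by lra.
  have -> : s = a by lra.
  by rewrite subrr normr0 ltW.
move=> c acb Pc.
have e20 : 0 < e / 2 by lra.
have [d d0 fd] := cf c acb _ e20.
have d20 : 0 < d / 2 by lra.
have [r0 [ar0b r0c [d1 d10 Pd1]]] := Pc _ d20.
exists (d / 2) => // s0 cs0 s0b.
exists (Num.min d1 (d / 2)); first by rewrite lt_min d10.
move=> r s rs0 ss0; rewrite le_min => /andP[rsd1 rsd2].
have [/andP[rr0 sr0]|] := boolP ((r <= r0) && (s <= r0)).
  by apply: Pd1 => //; lra.
rewrite negb_and -!ltNge => far.
have := ler_distD (f c) (f r) (f s).
move: rsd2; rewrite ler_norml => /andP[rsd2 rsd3].
have near q : a <= q <= s0 -> c - d <= q -> `|f q - f c| <= e / 2.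
  by move=> aqs0 cq; apply: fd; [lra|rewrite ler_norml; lra].
have Hr : `|f r - f c| <= e / 2 by apply: near => //; case/orP: far; lra.
have Hs : `|f s - f c| <= e / 2 by apply: near => //; case/orP: far; lra.
rewrite (distrC (f c) (f s)); lra.
Qed.

Lemma continuous_between_bounded (a b : R) f : a <= b ->
  continuous_between a b f ->
  exists K : R, forall r : R, a <= r <= b -> `|f r| <= K.
Proof.
move=> ab cf.
apply: (@real_induction a b
  (fun c : R => exists K : R, forall r : R, a <= r <= c -> `|f r| <= K)) => //.
  by exists `|f a| => r ra; have -> : r = a by lra.
move=> c acb Pc.
have [d d0 fd] := cf c acb _ ltr01.
have [r0 [ar0b r0c [K PK]]] := Pc _ d0.
exists d => // s0 cs0 s0b; exists (Num.max K (`|f c| + 1)) => r rs0.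
rewrite le_max; have [rr0|r0r] := leP r r0; first by rewrite PK//; lra.
apply/orP; right; rewrite -[f r](subrK (f c)) (le_trans (ler_normD _ _))//.
by rewrite addrC lerD2l fd// ?ler_norml; lra.
Qed.

End calculus.

(** * Polygons and primitives of vector-valued functions *)

Section primitives.
Context {R : realType} {X : normedModType R}.
Implicit Types (u : R -> X) (p : nat -> X) (v : X).

(** The piecewise linear curve through the vectors [p j] at the times
    [j * tau]. *)
Definition polygon (tau : R) p (s : R) : X :=
  let j := Num.trunc (s / tau) in p j + (s / tau - j%:R) *: (p j.+1 - p j).

Lemma polygonE (tau : R) p (j : nat) (s : R) : 0 < tau ->
  j%:R * tau <= s <= j.+1%:R * tau ->
  polygon tau p s = p j + (s / tau - j%:R) *: (p j.+1 - p j).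
Proof.
move=> tau0 /andP[js]; rewrite le_eqVlt => /orP[/eqP sj|sj]; last first.
  rewrite /polygon (@trunc_def _ _ j)//.
  by rewrite ler_pdivlMr// ltr_pdivrMr// js.
rewrite /polygon (@trunc_def _ _ j.+1); last first.
  by rewrite sj mulfK ?gt_eqF// lexx ltr_nat ltnS leqnn.
rewrite sj mulfK ?gt_eqF// subrr -natr1.
linear_comb.
Qed.

Lemma polygon0 (tau : R) p : 0 < tau -> polygon tau p 0 = p 0%N.
Proof.
move=> t0; rewrite (@polygonE _ _ 0%N)//; last by rewrite mul0r lexx/= mulr_ge0// ltW.
by rewrite mul0r subrr scale0r addr0.
Qed.

Lemma polygon_node (tau : R) p (j : nat) : 0 < tau ->
  polygon tau p (j%:R * tau) = p j.
Proof.
move=> t0; rewrite (@polygonE _ _ j)//.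
  by rewrite mulfK ?gt_eqF// subrr scale0r addr0.
by rewrite lexx ler_wpM2r ?ler_nat// ltW.
Qed.

Lemma exists_cell (tau s : R) : 0 < tau -> 0 <= s ->
  exists j : nat, j%:R * tau <= s < j.+1%:R * tau.
Proof.
move=> t0 s0; exists (Num.trunc (s / tau)).
rewrite -ler_pdivlMr// -ltr_pdivrMr//.
by apply: trunc_itv; rewrite divr_ge0// ltW.
Qed.

(** If every edge met by [[a, b]] has slope within [C] of [v], then so has the
    whole chord; this replaces integrating the piecewise constant derivative. *)
Lemma polygon_slope (tau a b C : R) p v : 0 < tau -> 0 <= a <= b ->
  (forall j : nat, a <= j.+1%:R * tau -> j%:R * tau <= b ->
    `|p j.+1 - p j - tau *: v| <= C * tau) ->
  `|polygon tau p b - polygon tau p a - (b - a) *: v| <= C * (b - a).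
Proof.
move=> t0 /andP[a0 ab] pC.
have cell (j : nat) c d : a <= c <= d -> d <= b ->
    j%:R * tau <= c -> d <= j.+1%:R * tau ->
    `|polygon tau p d - polygon tau p c - (d - c) *: v| <= C * (d - c).
  move=> acd db jc dj.
  rewrite (@polygonE tau p j d)//; last lra.
  rewrite (@polygonE tau p j c)//; last lra.
  have tn : tau != 0 by rewrite gt_eqF.
  rewrite (_ : _ - _ - _ = (d - c) / tau *: (p j.+1 - p j - tau *: v)); last first.
    linear_comb.
  rewrite normrZ ger0_norm; last by apply: divr_ge0; lra.
  rewrite (_ : C * (d - c) = (d - c) / tau * (C * tau)); last by field.
  apply: ler_wpM2l; first by apply: divr_ge0; lra.
  by apply: pC; lra.
suff main (j : nat) c : a <= c <= b -> c <= j.+1%:R * tau ->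
    `|polygon tau p c - polygon tau p a - (c - a) *: v| <= C * (c - a).
  have [j /andP[_ jb]] := exists_cell t0 (le_trans a0 ab).
  by apply: (main j); lra.
elim: j c => [|j IH] c acb cj.
  by apply: (cell 0%N); lra.
have [ja|aj] := leP (j.+1%:R * tau) a; first by apply: (cell j.+1); lra.
have [cj'|jc] := leP c (j.+1%:R * tau); first by apply: IH.
have H1 := IH (j.+1%:R * tau) ltac:(lra) (lexx _).
have H2 := cell j.+1 (j.+1%:R * tau) c ltac:(lra) ltac:(lra) (lexx _) cj.
rewrite (_ : _ - _ - _ = (polygon tau p (j.+1%:R * tau) - polygon tau p a -
  (j.+1%:R * tau - a) *: v) + (polygon tau p c - polygon tau p (j.+1%:R * tau) -
  (c - j.+1%:R * tau) *: v)); last linear_comb.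
by rewrite (le_trans (ler_normD _ _))//; lra.
Qed.

Definition sequentially_complete := forall w : nat -> X,
  (forall e : R, 0 < e -> exists N, forall n m, (N <= n)%N -> (N <= m)%N ->
    `|w n - w m| <= e) ->
  exists l, forall e : R, 0 < e -> exists N, forall n, (N <= n)%N ->
    `|w n - l| <= e.

Lemma exists_invS_le (d : R) : 0 < d ->
  exists N : nat, forall n, (N <= n)%N -> n.+1%:R^-1 <= d.
Proof.
move=> d0; exists (Num.bound d^-1) => n Nn.
rewrite invf_ple ?posrE//.
have := archi_boundP (ltW (_ : 0 < d^-1)); rewrite invr_gt0 => /(_ d0) /ltW dN.
by apply: le_trans dN _; rewrite ler_nat leqW.
Qed.

(** The characterisation by chords contains both the differentiability of [U]
    with derivative [u] and its continuity.  The approximants are the primitives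
    of the step functions that sample [u] with step [1 / n.+1]; the difference
    of two of them has small slope by uniform continuity of [u], hence is small
    by the mean value inequality, which makes them Cauchy at every point. *)
Lemma exists_primitive u : sequentially_complete ->
  (forall b : R, 0 <= b -> continuous_between 0 b u) ->
  exists U : R -> X, forall (a b C : R) v, 0 <= a <= b ->
    (forall r : R, a <= r <= b -> `|u r - v| <= C) ->
    `|U b - U a - (b - a) *: v| <= C * (b - a).
Proof.
move=> cX cu.
pose tau n : R := n.+1%:R^-1.
have tau0 n : 0 < tau n by rewrite invr_gt0.
pose nodes n j := \sum_(k < j) tau n *: u (k%:R * tau n).
pose U n := polygon (tau n) (nodes n).
have U0 n : U n 0 = 0 by rewrite /U polygon0// /nodes big_ord0.
have Uslope (B e : R) : 0 <= B -> 0 < e -> exists N, forall n, (N <= n)%N ->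
    forall (a b C : R) v, 0 <= a -> a <= b <= B ->
    (forall r : R, a <= r <= b -> `|u r - v| <= C) ->
    `|U n b - U n a - (b - a) *: v| <= (C + e) * (b - a).
  move=> B0 e0; have [d d0 du] := continuous_between_uniform B0 (cu _ B0) e0.
  have [N tauN] := exists_invS_le d0.
  exists N => n Nn a b C v a0 abB uC.
  apply: polygon_slope => //; first lra.
  move=> j aj jb.
  rewrite {1}/nodes big_ord_recr/= -/(nodes n j) (addrC (nodes n j)) addrK -scalerBr normrZ.
  rewrite gtr0_norm// [leLHS]mulrC ler_wpM2r ?(ltW (tau0 n))//.
  (* the sampling point of the first edge may precede [a], by at most one step *)
  have [aj'|ja] := leP a (j%:R * tau n).
    by rewrite (le_trans (uC _ _))//; lra.
  have jt0 : 0 <= j%:R * tau n by rewrite mulr_ge0// ltW.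
  have tnd : tau n <= d by apply: tauN.
  have : `|u (j%:R * tau n) - u a| <= e.
    apply: du; try lra.
    rewrite distrC ger0_norm; last lra.
    by move: aj; rewrite -natr1; lra.
  have := uC a ltac:(lra).
  have := ler_distD (u a) (u (j%:R * tau n)) v; lra.
have Ucauchy s : 0 <= s -> forall e : R, 0 < e -> exists N, forall n m,
    (N <= n)%N -> (N <= m)%N -> `|U n s - U m s| <= e.
  move=> s0 e0 e00; pose e := e0 / (4 * (s + 1)).
  have e_gt0 : 0 < e by apply: divr_gt0 => //; lra.
  have [d d0 du] := continuous_between_uniform s0 (cu _ s0) e_gt0.
  have [N UN] := Uslope s e s0 e_gt0.
  exists N => n m Nn Nm; pose D r := U n r - U m r.
  have DL (a b : R) : 0 <= a -> a <= b <= s -> b - a <= d ->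
      `|D b - D a| <= 4 * e * (b - a).
    move=> a0 abs bad.
    have ue r : a <= r <= b -> `|u r - u a| <= e.
      by move=> arb; apply: du; try lra; rewrite ler_norml; lra.
    have := UN n Nn a b e (u a) a0 abs ue.
    have := UN m Nm a b e (u a) a0 abs ue.
    rewrite (_ : D b - D a = (U n b - U n a - (b - a) *: u a) -
      (U m b - U m a - (b - a) *: u a)); last by rewrite /D; linear_comb.
    by move=> H1 H2; rewrite (le_trans (ler_normB _ _))//; lra.
  have -> : U n s - U m s = D s - D 0 by rewrite /D !U0 subrr subr0.
  apply: (@le_trans _ _ (4 * e * (s - 0))); last first.
    have -> : 4 * e = e0 / (s + 1) by rewrite /e; field; lra.
    by rewrite subr0 -mulrA ger_pMr// ler_pdivrMl; lra.
  apply: mean_value_inequality => //; first lra.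
    move=> r rs e1 e10; exists (Num.min d (e1 / (4 * e))).
      by rewrite lt_min d0 divr_gt0//; lra.
    have ee : 4 * e * (e1 / (4 * e)) = e1 by field; lra.
    have near a b : 0 <= a -> a <= b -> b <= s ->
        b - a <= Num.min d (e1 / (4 * e)) -> `|D b - D a| <= e1.
      move=> a0 ab bs; rewrite le_min => /andP[bad bae].
      apply: le_trans (DL a b a0 _ bad) _; first by rewrite ab.
      by rewrite -[leRHS]ee ler_wpM2l// mulr_ge0// ltW.
    move=> q /andP[q0 qs]; move/andP: rs => [r0 rs].
    have [qr|/ltW rq] := leP r q => qd.
      by apply: near => //; apply: le_trans (ler_norm _) qd.
    rewrite distrC; apply: near => //.
    by apply: le_trans (ler_norm _) _; rewrite distrC.
  move=> r rs e1 e10; exists d => // h hd rhs.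
  have := DL r (r + h) ltac:(lra) ltac:(lra) ltac:(lra).
  rewrite (_ : r + h - r = h); last ring.
  by move=> H; rewrite (le_trans H)// ler_wpM2r//; lra.
have /choice[V Vlim] : forall s : R, exists l : X, 0 <= s ->
    forall e : R, 0 < e -> exists N, forall n, (N <= n)%N -> `|U n s - l| <= e.
  move=> s; have [s0|s0] := leP 0 s; last by exists 0.
  by have [l lP] := cX _ (Ucauchy s s0); exists l.
exists V => a b C v abC uC.
apply/ler_addgt0Pl => e0 e00; pose e := e0 / (b - a + 2).
have e_gt0 : 0 < e by apply: divr_gt0 => //; lra.
have ee : e0 = e * (b - a + 2) by rewrite /e; field; lra.
have [Na Ha] := Vlim a ltac:(lra) e e_gt0.
have [Nb Hb] := Vlim b ltac:(lra) e e_gt0.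
have [N HN] := Uslope b e ltac:(lra) e_gt0.
pose n := maxn N (maxn Na Nb).
have := HN n (leq_maxl _ _) a b C v ltac:(lra) ltac:(lra) uC.
have := Ha n ltac:(by rewrite /n !leq_max leqnn orbT).
have := Hb n ltac:(by rewrite /n !leq_max leqnn !orbT).
move=> hb ha hn.
rewrite (_ : V b - V a - (b - a) *: v = (U n b - U n a - (b - a) *: v) +
  ((U n a - V a) - (U n b - V b))); last linear_comb.
rewrite (le_trans (ler_normD _ _))//.
have := ler_normB (U n a - V a) (U n b - V b); nra.
Qed.

End primitives.
Arguments sequentially_complete {R} X.

(** * Semigroups and their generators *)

Section linear_maps.
Context {R : realType} {X Y : normedModType R}.
Implicit Types f : X -> Y.

Lemma linear_mapD f : linear f -> forall x y, f (x + y) = f x + f y.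
Proof. by move=> lf x y; have := lf 1 x y; rewrite !scale1r. Qed.

Lemma linear_map0 f : linear f -> f 0 = 0.
Proof.
by move=> lf; have := linear_mapD lf 0 0; rewrite addr0 => /(canLR (addrK _)); rewrite subrr.
Qed.

Lemma linear_mapZ f : linear f -> forall a x, f (a *: x) = a *: f x.
Proof. by move=> lf a x; have := lf a x 0; rewrite linear_map0// !addr0. Qed.

Lemma linear_mapB f : linear f -> forall x y, f (x - y) = f x - f y.
Proof.
by move=> lf x y; rewrite linear_mapD// -[- y]scaleN1r linear_mapZ// scaleN1r.
Qed.

Lemma linear_bound_of_ball f (r C : R) : linear f -> 0 < r ->
  (forall x, `|x| <= r -> `|f x| <= C) -> forall x, `|f x| <= C / r * `|x|.
Proof.
move=> lf r0 fC x; have [->|x0] := eqVneq x 0.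
  by rewrite linear_map0// !normr0 mulr0.
have nx : 0 < `|x| by rewrite normr_gt0.
have nx' : `|x| != 0 by rewrite gt_eqF.
have rx : 0 <= r / `|x| by apply: divr_ge0; exact: ltW.
have := fC ((r / `|x|) *: x).
rewrite normrZ (ger0_norm rx) divfK// => /(_ (lexx _)).
rewrite linear_mapZ// normrZ (ger0_norm rx).
by rewrite mulrAC ler_pdivrMr// mulrAC ler_pdivlMr// mulrC.
Qed.

Lemma continuous_linear_bound f : linear f -> continuous f ->
  exists2 K : R, 0 <= K & forall x, `|f x| <= K * `|x|.
Proof.
move=> lf cf; have /cvgrPdist_le/(_ _ ltr01) := cf 0; rewrite (linear_map0 lf).
move=> /nbhs_ballP[d /= d0 fd]; exists (1 / (d / 2)).
  by apply: divr_ge0 => //; lra.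
apply: linear_bound_of_ball => //; first lra.
move=> x xd; have := fd x; rewrite -ball_normE /ball_/= !sub0r !normrN.
by apply; lra.
Qed.

End linear_maps.

Section semigroups.
Context {R : realType} {X : normedModType R}.
Variables (T : R -> X -> X) (sgT : strongly_continuous_semigroup T).

Lemma semigroup_linear_bound (t : R) : 0 <= t ->
  exists2 K : R, 0 <= K & forall x, `|T t x| <= K * `|x|.
Proof.
move=> t0; apply: continuous_linear_bound; first exact: semigroup_linear.
exact: semigroup_bounded.
Qed.

Lemma semigroup_orbit_continuous (a b : R) (x : X) : 0 <= a ->
  continuous_between a b (fun s => T s x).
Proof.
move=> a0 s asb e e0.
have /subspace_continuousP/(_ s) := @semigroup_orbit _ _ _ sgT x.
rewrite /Rplus/= => /(_ ltac:(lra)) /cvgrPdist_le/(_ _ e0).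
rewrite near_withinE => /nbhs_ballP[d /= d0 Td].
exists (d / 2); first lra.
move=> r arb rs; rewrite distrC; apply: Td; last lra.
by rewrite /ball/= distrC; lra.
Qed.

Lemma orbit_right_continuous (x : X) (e : R) : 0 < e -> exists2 d : R, 0 < d &
  forall h : R, 0 <= h <= d -> `|T h x - x| <= e.
Proof.
move=> e0; have [|d d0 Td] := @semigroup_orbit_continuous 0 1 x (lexx _) 0 _ e e0.
  by rewrite lexx ler01.
exists (Num.min d 1); first by rewrite lt_min d0 ltr01.
move=> h /andP[h0]; rewrite le_min => /andP[hd h1].
rewrite -[x in _ - x](semigroup0 sgT); apply: Td; first lra.
by rewrite subr0 ger0_norm.
Qed.

Variables (A : operator X) (genA : is_generator A T).

(** The form in which derivatives at [0] are used: an error [e * h] adds up to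
    [e * t] along a partition of [[0, t]]. *)
Lemma diff_quotient_cvgP (x y : X) : diff_quotient T x h @[h --> 0^'+] --> y <->
  forall e : R, 0 < e -> exists2 d : R, 0 < d &
    forall h : R, 0 < h <= d -> `|T h x - x - h *: y| <= e * h.
Proof.
have quot (h : R) : 0 < h ->
    `|y - diff_quotient T x h| = h^-1 * `|T h x - x - h *: y|.
  move=> h0; have hn : h != 0 by rewrite gt_eqF.
  rewrite distrC (_ : _ - y = h^-1 *: (T h x - x - h *: y)).
    by rewrite normrZ gtr0_norm// invr_gt0.
  by rewrite /diff_quotient; linear_comb.
split=> [/cvgrPdist_le H e e0|H].
  have := H e e0; rewrite near_withinE => /nbhs_ballP[d /= d0 Hd].
  exists (d / 2); first lra.
  move=> h h0d; have h0 : 0 < h by lra.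
  have := Hd h; rewrite /ball/= sub0r normrN gtr0_norm// => /(_ ltac:(lra) h0).
  by rewrite quot// ler_pdivrMl// mulrC.
apply/cvgrPdist_le => e e0; have [d d0 Hd] := H e e0.
rewrite near_withinE; apply/nbhs_ballP; exists d => //= h.
rewrite /ball/= sub0r normrN => hd h0; rewrite quot// ler_pdivrMl// mulrC.
by apply: Hd; rewrite h0 -(gtr0_norm h0) ltW.
Qed.

Lemma generator_derivative (x : X) : dom A x ->
  forall e : R, 0 < e -> exists2 d : R, 0 < d &
    forall h : R, 0 < h <= d -> `|T h x - x - h *: act A x| <= e * h.
Proof. by move=> Ax; apply/diff_quotient_cvgP; apply: (proj2 genA). Qed.

Lemma generator_intro (x y : X) :
  (forall e : R, 0 < e -> exists2 d : R, 0 < d &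
    forall h : R, 0 < h <= d -> `|T h x - x - h *: y| <= e * h) ->
  dom A x /\ act A x = y.
Proof.
move=> /diff_quotient_cvgP xy.
have Ax : dom A x by rewrite (proj1 genA)/=; apply/cvg_ex; exists y.
split=> //; apply: cvg_unique xy; first exact: norm_hausdorff.
exact: (proj2 genA).
Qed.

Lemma generator_orbit (x : X) (t : R) : 0 <= t -> dom A x ->
  dom A (T t x) /\ act A (T t x) = T t (act A x).
Proof.
move=> t0 Ax; apply: generator_intro => e e0.
have [K K0 TK] := semigroup_linear_bound t0.
have eK : 0 < e / (K + 1) by apply: divr_gt0 => //; lra.
have [d d0 Ad] := generator_derivative Ax eK.
exists d => // h hd; have h0 : 0 < h by lra.
have lT := semigroup_linear sgT t0.
rewrite -(semigroupD sgT) ?(ltW h0)// (addrC h) (semigroupD sgT) ?(ltW h0)//.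
rewrite -(linear_mapZ lT) -!(linear_mapB lT) (le_trans (TK _))//.
have {}Ad := Ad h hd.
apply: (@le_trans _ _ ((K + 1) * (e / (K + 1) * h))).
  by apply: ler_pM => //; lra.
by rewrite mulrA mulrCA divff ?mulr1//; lra.
Qed.

(** The vectors [d^-1 * S d], where [S] is the primitive of the orbit of [x]
    that vanishes at [0], tend to [x].  They belong to the domain because
    [T r (S d) = S (r + d) - S r]: both sides are functions of [d] vanishing at
    [0] with the same right derivative [T (r + d) x].  Hence the difference
    quotient of [T] at [S d] tends to [T d x - x]. *)
Lemma dom_generator_dense : sequentially_complete X ->
  forall (x : X) (e : R), 0 < e -> exists2 y, dom A y & `|x - y| <= e.
Proof.
move=> cX x e e0.
have cT (b : R) : 0 <= b -> continuous_between 0 b (fun s => T s x).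
  by move=> _; exact: semigroup_orbit_continuous.
have [U HU] := exists_primitive cX cT.
pose S (r : R) := U r - U 0.
have SU (a b C : R) v : 0 <= a <= b ->
    (forall r : R, a <= r <= b -> `|T r x - v| <= C) ->
    `|S b - S a - (b - a) *: v| <= C * (b - a).
  move=> ab Tv; rewrite (_ : S b - S a = U b - U a); first exact: HU.
  by rewrite /S; linear_comb.
have S0 : S 0 = 0 by rewrite /S subrr.
clearbody S.
have S_slope (s : R) : 0 <= s -> forall e1 : R, 0 < e1 -> exists2 d : R, 0 < d &
    forall h : R, 0 < h <= d -> `|S (s + h) - S s - h *: T s x| <= e1 * h.
  move=> s0 e1 e10.
  have [|d d0 Td] := @semigroup_orbit_continuous 0 (s + 1) x (lexx _) s _ e1 e10.
    by lra.
  exists (Num.min d 1); first by rewrite lt_min d0 ltr01.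
  move=> h /andP[h0]; rewrite le_min => /andP[hd h1].
  rewrite -{2 3}(_ : s + h - s = h); last ring.
  apply: SU; first lra.
  by move=> r sr; apply: Td; [lra|rewrite ler_norml; lra].
have [d d0 Td] := orbit_right_continuous x e0.
have translate (r : R) : 0 <= r -> T r (S d) = S (r + d) - S r.
  move=> r0; have lT := semigroup_linear sgT r0.
  have [K K0 TK] := semigroup_linear_bound r0.
  pose D s := T r (S s) - (S (r + s) - S r).
  have D0 : D 0 = 0 by rewrite /D S0 addr0 subrr subr0 linear_map0.
  suff : `|D d - D 0| <= 0 * (d - 0).
    by rewrite mul0r normr_le0 D0 subr0 => /eqP; rewrite /D => /subr0_eq.
  have [C TC] := continuous_between_bounded (addr_ge0 r0 (ltW d0))
    (cT _ (addr_ge0 r0 (ltW d0))).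
  have SL (a b : R) : 0 <= a <= b -> b <= r + d -> `|S b - S a| <= C * (b - a).
    move=> ab brd; have := SU a b C 0 ab.
    rewrite scaler0 subr0; apply=> q qab; rewrite subr0; apply: TC; lra.
  have C0 : 0 <= C by apply: le_trans (normr_ge0 _) (TC 0 _); lra.
  have DL (a b : R) : 0 <= a <= b -> b <= d ->
      `|D b - D a| <= (K + 1) * C * (b - a).
    move=> ab bd.
    rewrite (_ : D b - D a = T r (S b - S a) - (S (r + b) - S (r + a))); last first.
      by rewrite /D (linear_mapB lT); linear_comb.
    have H1 := SL a b ab ltac:(lra).
    have H2 := SL (r + a) (r + b) ltac:(lra) ltac:(lra).
    have H3 := TK (S b - S a).
    have H4 : K * `|S b - S a| <= K * (C * (b - a)) by rewrite ler_wpM2l.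
    by rewrite (le_trans (ler_normB _ _))//; lra.
  apply: mean_value_inequality => //; first lra.
    move=> s sd e1 e10.
    pose L := (K + 1) * C + 1.
    have L0 : 0 < L by rewrite /L ltr_wpDl// mulr_ge0//; lra.
    exists (e1 / L); first exact: divr_gt0.
    have bnd a b : 0 <= a <= b -> b <= d -> b - a <= e1 / L ->
        `|D b - D a| <= e1.
      move=> ab bd; rewrite ler_pdivlMr// => Le.
      by have := DL a b ab bd; rewrite /L in Le; lra.
    move=> q qd; rewrite ler_norml => qs.
    have [sq|qs'] := leP s q; first by apply: bnd; lra.
    by rewrite distrC; apply: bnd; lra.
  move=> s sd e1 e10.
  have eK : 0 < e1 / (K + 1) by apply: divr_gt0 => //; lra.
  have [d1 d10 H1] := S_slope s ltac:(lra) _ eK.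
  have [d2 d20 H2] := S_slope (r + s) ltac:(lra) _ eK.
  exists (Num.min d1 d2); first by rewrite lt_min d10.
  move=> h /andP[h0]; rewrite le_min => /andP[hd1 hd2] shd.
  have {}H1 := H1 h ltac:(lra); have := H2 h ltac:(lra).
  rewrite -(addrA r) => {}H2; have := TK (S (s + h) - S s - h *: T s x).
  rewrite !(linear_mapB lT) (linear_mapZ lT) -(semigroupD sgT)//; last lra.
  rewrite (_ : D (s + h) - D s = (T r (S (s + h)) - T r (S s) - h *: T (r + s) x)
    - (S (r + (s + h)) - S (r + s) - h *: T (r + s) x)); last first.
    by rewrite /D; linear_comb.
  move=> H3; have H4 : K * `|S (s + h) - S s - h *: T s x| <= K * (e1 / (K + 1) * h).
    by rewrite ler_wpM2l.
  have -> : (0 + e1) * h = (K + 1) * (e1 / (K + 1) * h) by field; lra.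
  apply: le_trans (ler_normB _ _) _.
  apply: le_trans (lerD (le_trans H3 H4) H2) _; lra.
have dn : d != 0 by rewrite gt_eqF.
exists (d^-1 *: S d); last first.
  have Hd : `|S d - d *: x| <= e * d.
    have := SU 0 d e x ltac:(lra).
    by rewrite S0 !subr0; apply=> r rd; apply: Td; lra.
  rewrite distrC (_ : _ - x = d^-1 *: (S d - d *: x)); last linear_comb.
  by rewrite normrZ gtr0_norm ?invr_gt0// ler_pdivrMl// mulrC.
suff [] : dom A (d^-1 *: S d) /\ act A (d^-1 *: S d) = d^-1 *: (T d x - x) by [].
apply: generator_intro => e1 e10.
have e1d : 0 < e1 * d / 2 by apply: divr_gt0 => //; apply: mulr_gt0.
have [d1 d10 H1] := S_slope d (ltW d0) _ e1d.
have [d2 d20 H2] := S_slope 0 (lexx _) _ e1d.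
exists (Num.min d1 d2); first by rewrite lt_min d10.
move=> h /andP[h0]; rewrite le_min => /andP[hd1 hd2].
rewrite linear_mapZ; last by apply: (semigroup_linear sgT); lra.
rewrite translate ?(ltW h0)//.
have := H1 h ltac:(lra); have := H2 h ltac:(lra).
rewrite add0r S0 subr0 (semigroup0 sgT) (addrC d h) => G2 G1.
rewrite (_ : _ - _ - _ = d^-1 *: ((S (h + d) - S d - h *: T d x) -
  (S h - h *: x))); last linear_comb.
rewrite normrZ gtr0_norm ?invr_gt0// ler_pdivrMl//.
apply: le_trans (ler_normB _ _) _; apply: le_trans (lerD G1 G2) _; lra.
Qed.

End semigroups.

Section completeness.
Context {R : realType}.

Lemma sequentially_complete_normed (X : completeNormedModType R) :
  sequentially_complete X.
Proof.
move=> w cw.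
have : cvg (w n @[n --> \oo]).
  apply: cauchy_cvg; apply: cauchy_exP => e e0.
  have e20 : 0 < e / 2 by rewrite divr_gt0.
  have [N wN] := cw _ e20; exists (w N); exists N => //= n /= Nn.
  rewrite -ball_normE /ball_/=; have := wN N n (leqnn _) Nn; lra.
move=> /cvg_ex[l /cvgrPdist_le wl]; exists l => e e0.
have [N _ HN] := wl e e0; exists N => n Nn.
by rewrite distrC; apply: HN.
Qed.

Lemma sequentially_complete_prod (X Y : normedModType R) :
  sequentially_complete X -> sequentially_complete Y ->
  sequentially_complete (X * Y)%type.
Proof.
move=> cX cY w cw.
have [|l1 H1] := cX (fun n => (w n).1).
  move=> e e0; have [N HN] := cw e e0; exists N => n m Nn Nm.
  have := HN n m Nn Nm; rewrite prod_normE ge_max => /andP[+ _]; exact.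
have [|l2 H2] := cY (fun n => (w n).2).
  move=> e e0; have [N HN] := cw e e0; exists N => n m Nn Nm.
  have := HN n m Nn Nm; rewrite prod_normE ge_max => /andP[_]; exact.
exists (l1, l2) => e e0; have [N1 HN1] := H1 e e0; have [N2 HN2] := H2 e e0.
exists (maxn N1 N2) => n; rewrite geq_max => /andP[n1 n2].
by rewrite prod_normE ge_max HN1//= HN2.
Qed.

End completeness.

(** * Growth bounds, and evaluation of functions vanishing at infinity *)

Section growth.
Context {R : realType} {E : completeNormedModType R}.

(** The operators [T s] with [0 <= s <= 1] are bounded by some [K >= 1]
    uniformly, by Banach-Steinhaus; each unit of time that is peeled
    off costs a factor [K], whence growth with exponent [ln K]. *)
Lemma semigroup_growth (T : R -> E -> E) : strongly_continuous_semigroup T ->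
  exists K c : R, [/\ 1 <= K, 0 <= c &
    forall (t : R) x, 0 <= t -> `|T t x| <= K * expR (c * t) * `|x|].
Proof.
move=> sgT; pose F := [set f | exists2 s : R, 0 <= s <= 1 & f = T s].
have [||C TC] := @Banach_Steinhauss R E E F _ _ 1.
- move=> _ [s /andP[s0 _] ->]; have lT := semigroup_linear sgT s0.
  split=> // r; have [K K0 TK] := semigroup_linear_bound sgT s0.
  by exists (K * r) => x xr; apply: le_trans (TK x) _; rewrite ler_wpM2l.
- move=> x; have [K TK] := continuous_between_bounded ler01
    (semigroup_orbit_continuous sgT (b := 1) x (lexx _)).
  by exists K => _ [s s01 ->]; exact: TK.
pose K := Num.max C 1.
have K1 : 1 <= K by rewrite le_max lexx orbT.
have K0 : 0 < K by lra.
have TK s x : 0 <= s <= 1 -> `|T s x| <= K * `|x|.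
  move=> s01; rewrite -[K in leRHS]divr1.
  apply: linear_bound_of_ball => // [|y y1].
    by apply: (semigroup_linear sgT); lra.
  apply: le_trans (TC (T s) _ y y1) _; first by exists s.
  by rewrite le_max lexx.
exists K, (ln K); split=> //; first exact: ln_ge0.
suff main n : forall (t : R) x, 0 <= t <= n.+1%:R ->
    `|T t x| <= K * expR (ln K * t) * `|x|.
  move=> t x t0; have [n /andP[_]] := exists_cell ltr01 t0.
  by rewrite mulr1 => tn; apply: (main n); rewrite t0 ltW.
have lnK0 : 0 <= ln K by exact: ln_ge0.
elim: n => [|n IH] t x tn.
  apply: le_trans (TK t x tn) _; rewrite ler_wpM2r// ler_peMr//; first lra.
  by rewrite -expR0 ler_expR mulr_ge0//; lra.
have [t1|t1] := leP t 1.
  apply: le_trans (TK t x _) _; first lra.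
  rewrite ler_wpM2r// ler_peMr//; first lra.
  by rewrite -expR0 ler_expR mulr_ge0//; lra.
have -> : T t x = T 1 (T (t - 1) x).
  by rewrite -(semigroupD sgT); [congr (T _ x); ring|lra|lra].
apply: le_trans (TK 1 _ _) _; first lra.
have IHt := IH (t - 1) x ltac:(by move: tn; rewrite -natr1; lra).
apply: (@le_trans _ _ (K * (K * expR (ln K * (t - 1)) * `|x|))).
  by rewrite ler_wpM2l//; lra.
rewrite mulrBr mulr1 expRD expRN lnK ?posrE//.
have Kn : K != 0 by rewrite gt_eqF.
by rewrite le_eqVlt; apply/orP; left; apply/eqP; field.
Qed.

End growth.

Section C0_calculus.
Context {R : realType} {E : completeNormedModType R}.
Implicit Types (f g : C0 R E).

Lemma C0_eval_continuous f (s : R) : forall e : R, 0 < e ->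
  exists2 d : R, 0 < d & forall r : R, `|r - s| <= d ->
    `|f (Rplus_clamp r) - f (Rplus_clamp s)| <= e.
Proof.
move=> e e0.
have cf : {for s, continuous (fun r : R => f (Rplus_clamp r))}.
  apply: continuous_comp; first exact: continuous_Rplus_clamp.
  exact: C0_continuous.
move: cf => /cvgrPdist_le/(_ _ e0)/nbhs_ballP[d /= d0 fd].
exists (d / 2); first lra.
move=> r rs; rewrite distrC; apply: fd; rewrite /ball/= distrC; lra.
Qed.

(** The derivative along the subspace [Rplus], expressed with real parameters
    through the continuous retraction [Rplus_clamp]. *)
Lemma has_derivativeP f (g : Rplus R -> E) (s : R) : has_derivative f g ->
  0 <= s -> forall e : R, 0 < e ->
  exists2 d : R, 0 < d & forall r : R, 0 <= r -> `|r - s| <= d ->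
    `|f (Rplus_clamp r) - f (Rplus_clamp s) - (r - s) *: g (Rplus_clamp s)|
      <= e * `|r - s|.
Proof.
move=> fg s0 e e0; have PF := Rplus_dnbhs_proper (Rplus_clamp s).
have /cvgrPdist_le/(_ _ e0) := fg (Rplus_clamp s).
rewrite /dnbhs near_withinE => fg'.
have /nbhs_ballP[d /= d0 Hd] := @continuous_Rplus_clamp R s _ fg'.
exists (d / 2); first lra.
move=> r r0 rs; have [->|rns] := eqVneq r s.
  by rewrite !subrr scale0r subr0 !normr0 mulr0.
have := Hd r; rewrite /ball/= distrC => /(_ ltac:(lra)).
rewrite (max_r r0) (max_r s0) => H.
have {}H : `|g (Rplus_clamp s) - (r - s)^-1 *:
    (f (Rplus_clamp r) - f (Rplus_clamp s))| <= e.
  apply: H; apply/eqP => /(congr1 val)/=; rewrite !max_r// => rs'.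
  by move: rns; rewrite rs' eqxx.
have rsn : r - s != 0 by rewrite subr_eq0.
rewrite (_ : _ - _ - _ = (s - r) *: (g (Rplus_clamp s) - (r - s)^-1 *:
    (f (Rplus_clamp r) - f (Rplus_clamp s)))); last by linear_comb.
by rewrite normrZ distrC mulrC ler_wpM2r.
Qed.

Lemma C01_deriv f : C01 f -> has_derivative f (deriv_C0 f).
Proof. by move=> [g fg]; rewrite (deriv_C0E fg). Qed.

End C0_calculus.

(** * Components of the block semigroups *)

Section components.
Context {R : realType} {Z : normedModType R}.
Variables (B : operator Z) (S : R -> Z -> Z).
Hypotheses (sgS : strongly_continuous_semigroup S) (genB : is_generator B S).
Hypothesis denseB : forall (u : Z) (e : R), 0 < e ->
  exists2 v, dom B v & `|u - v| <= e.

(** An inequality between functions that are Lipschitz on the semigroup's space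
    passes from the domain of the generator to the whole space. *)
Lemma dense_le (p q : Z -> R) (L : R) : 0 <= L ->
  (forall u v, p u <= p v + L * `|u - v|) ->
  (forall u v, q v <= q u + L * `|u - v|) ->
  (forall v, dom B v -> p v <= q v) -> forall u, p u <= q u.
Proof.
move=> L0 pL qL pq u; apply/ler_addgt0Pl => e e0.
have eL : 0 < e / (2 * L + 1) by apply: divr_gt0 => //; lra.
have [v Bv uv] := denseB u eL.
have := pL u v; have := qL u v; have := pq v Bv.
have : L * `|u - v| <= L * (e / (2 * L + 1)) by rewrite ler_wpM2l.
have : 2 * (L * (e / (2 * L + 1))) <= e.
  rewrite (_ : 2 * _ = (2 * L) / (2 * L + 1) * e); last by field; lra.
  by rewrite ler_piMl ?(ltW e0)// ler_pdivrMr; lra.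
lra.
Qed.

Lemma orbit_derivative (u : Z) (s : R) : dom B u -> 0 <= s ->
  forall e : R, 0 < e -> exists2 d : R, 0 < d & forall h : R, 0 < h <= d ->
    `|S (s + h) u - S s u - h *: act B (S s u)| <= e * h.
Proof.
move=> Bu s0 e e0; have [Bs _] := generator_orbit sgS genB s0 Bu.
have [d d0 Hd] := generator_derivative genB Bs e0.
exists d => // h hd; rewrite (addrC s) (semigroupD sgS)//; [exact: Hd|lra].
Qed.

(** The right derivative of [s |-> pi (S s u)] is [pi (B (S s u)) = 0]. *)
Lemma component_conserved (Y : normedModType R) (pi : Z -> Y) : linear pi ->
  (forall u, `|pi u| <= `|u|) -> (forall u, dom B u -> pi (act B u) = 0) ->
  forall u (t : R), 0 <= t -> pi (S t u) = pi u.
Proof.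
move=> lpi pi1 piB u t t0; apply/eqP; rewrite -subr_eq0 -normr_le0.
have [K K0 SK] := semigroup_linear_bound sgS t0.
apply: (@dense_le (fun u => `|pi (S t u) - pi u|) (fun=> 0) (K + 1)).
- lra.
- move=> {}u v; rewrite -[pi (S t u) - _](subrK (pi (S t v) - pi v)).
  rewrite addrC; apply: le_trans (ler_normD _ _) _; rewrite lerD2l.
  have -> : pi (S t u) - pi u - (pi (S t v) - pi v) = pi (S t (u - v) - (u - v)).
    rewrite !(linear_mapB lpi) (linear_mapB (semigroup_linear sgS t0)).
    by rewrite (linear_mapB lpi); linear_comb.
  apply: le_trans (pi1 _) _; apply: le_trans (ler_normB _ _) _.
  by have := SK (u - v); lra.
- by move=> {}u v; rewrite add0r mulr_ge0//; lra.
move=> {}u Bu.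
rewrite -{2}(semigroup0 sgS u) -[leRHS](mul0r (t - 0)).
apply: (@mean_value_inequality _ _ _ _ _ (fun s => pi (S s u))) => //.
  move=> s st e e0.
  have [d d0 Hd] := semigroup_orbit_continuous sgS u (lexx 0) st e0.
  exists d => // r rt rs; rewrite -(linear_mapB lpi).
  by apply: le_trans (pi1 _) (Hd r rt rs).
move=> s st e e0; have [|d d0 Hd] := @orbit_derivative u s Bu _ e e0.
  by lra.
exists d => // h hd sht; rewrite add0r.
have s0 : 0 <= s by lra.
have [Bs _] := generator_orbit sgS genB s0 Bu.
have -> : pi (S (s + h) u) - pi (S s u) =
    pi (S (s + h) u - S s u - h *: act B (S s u)).
  by rewrite !(linear_mapB lpi) (linear_mapZ lpi) (piB _ Bs) scaler0 subr0.
exact: le_trans (pi1 _) (Hd h hd).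
Qed.

Context {E : completeNormedModType R}.

(** A component whose evolution is generated by differentiation is translated:
    along the characteristic [r |-> q + t - r] the value of [pi (S r u)] has
    right derivative [g - g = 0], [g] being the spatial derivative of
    [pi (S r u)]. *)
Lemma shift_component (pi : Z -> C0 R E) : linear pi ->
  (forall u, `|pi u| <= `|u|) ->
  (forall u, dom B u -> C01 (pi u) /\ pi (act B u) = deriv_C0 (pi u)) ->
  forall u, dom B u -> forall q t : R, 0 <= q -> 0 <= t ->
    pi (S t u) (Rplus_clamp q) = pi u (Rplus_clamp (q + t)).
Proof.
move=> lpi pi1 piB u Bu q t q0 t0.
pose psi r := pi (S r u) (Rplus_clamp (q + t - r)).
suff : `|psi t - psi 0| <= 0 * (t - 0).
  rewrite mul0r normr_le0 subr_eq0 => /eqP; rewrite /psi subr0 addrK.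
  by rewrite (semigroup0 sgS).
have evB (f g : C0 R E) s : `|f s - g s| <= `|f - g| by exact: (le_sup_norm (f - g)).
apply: mean_value_inequality => //.
  move=> s st e e0; have e20 : 0 < e / 2 by lra.
  have [d1 d10 H1] := semigroup_orbit_continuous sgS u (lexx 0) st e20.
  have [d2 d20 H2] := C0_eval_continuous (pi (S s u)) (q + t - s) e20.
  exists (Num.min d1 d2); first by rewrite lt_min d10.
  move=> r rt; rewrite le_min => /andP[rs1 rs2].
  have := ler_distD (pi (S s u) (Rplus_clamp (q + t - r))) (psi r) (psi s).
  have := H1 r rt rs1; have := pi1 (S r u - S s u); rewrite (linear_mapB lpi).
  have := evB (pi (S r u)) (pi (S s u)) (Rplus_clamp (q + t - r)).
  have := H2 (q + t - r); rewrite (_ : q + t - r - _ = s - r); last ring.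
  rewrite (distrC s r) => /(_ rs2); rewrite /psi; lra.
move=> s st e e0; have s0 : 0 <= s by lra.
have [Bs _] := generator_orbit sgS genB s0 Bu.
have [C01s piBs] := piB _ Bs.
have e30 : 0 < e / 3 by lra.
pose g := deriv_C0 (pi (S s u)); pose a := q + t - s.
have a0 : 0 <= a by rewrite /a; lra.
have [d1 d10 H1] := orbit_derivative Bu s0 e30.
have [d2 d20 H2] := has_derivativeP (C01_deriv C01s) a0 e30.
have [d3 d30 H3] := C0_eval_continuous g a e30.
exists (Num.min d1 (Num.min d2 d3)); first by rewrite !lt_min d10 d20.
move=> h /andP[h0]; rewrite !le_min => /and3P[hd1 hd2 hd3] sht.
have ha : `|a - h - a| = h by rewrite addrAC subrr sub0r normrN gtr0_norm.
have := H3 (a - h); rewrite ha => /(_ hd3) {}H3.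
have := H2 (a - h) ltac:(rewrite /a; lra); rewrite ha => /(_ hd2) {}H2.
have {}H1 := H1 h ltac:(lra).
have := pi1 (S (s + h) u - S s u - h *: act B (S s u)).
rewrite !(linear_mapB lpi) (linear_mapZ lpi) piBs -/g => H4.
have H5 := le_sup_norm (pi (S (s + h) u) - pi (S s u) - h *: g) (Rplus_clamp (a - h)).
rewrite -C0_normE in H5.
have -> : psi (s + h) - psi s =
    (pi (S (s + h) u) (Rplus_clamp (a - h)) - pi (S s u) (Rplus_clamp (a - h)) -
      h *: g (Rplus_clamp (a - h))) +
    (pi (S s u) (Rplus_clamp (a - h)) - pi (S s u) (Rplus_clamp a) -
      (a - h - a) *: g (Rplus_clamp a)) +
    h *: (g (Rplus_clamp (a - h)) - g (Rplus_clamp a)).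
  rewrite /psi (_ : q + t - (s + h) = a - h); last by rewrite /a; ring.
  by rewrite -/a; linear_comb.
apply: le_trans (ler_normD _ _) _; apply: le_trans (lerD (ler_normD _ _) (lexx _)) _.
rewrite normrZ gtr0_norm//.
apply: le_trans (lerD (lerD (le_trans H5 (le_trans H4 H1)) H2)
  (ler_wpM2l (ltW h0) H3)) _; lra.
Qed.

Lemma shift_component_le (pi : Z -> C0 R E) : linear pi ->
  (forall u, `|pi u| <= `|u|) ->
  (forall u, dom B u -> C01 (pi u) /\ pi (act B u) = deriv_C0 (pi u)) ->
  forall u (t : R), 0 <= t -> `|pi (S t u)| <= `|pi u|.
Proof.
move=> lpi pi1 piB u t t0; have [K K0 SK] := semigroup_linear_bound sgS t0.
have piL v w : `|pi v| <= `|pi w| + `|v - w|.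
  rewrite -[pi v](subrK (pi w)) addrC -(linear_mapB lpi).
  by apply: le_trans (ler_normD _ _) _; rewrite lerD2l.
apply: (@dense_le (fun u => `|pi (S t u)|) (fun u => `|pi u|) (K + 1)).
- lra.
- move=> {}u v; apply: le_trans (piL _ (S t v)) _.
  rewrite -(linear_mapB (semigroup_linear sgS t0)) lerD2l.
  by apply: le_trans (SK _) _; rewrite ler_wpM2r//; lra.
- move=> {}u v; apply: le_trans (piL _ u) _; rewrite lerD2l distrC.
  by rewrite ler_peMl//; lra.
move=> {}u Bu; apply: sup_norm_le => s; rewrite -(Rplus_clampK s).
rewrite (shift_component lpi)//; first exact: le_sup_norm.
by have := valP s; rewrite inE.
Qed.

Variables (A : operator E) (T : R -> E -> E).
Hypotheses (sgT : strongly_continuous_semigroup T) (genA : is_generator A T).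

(** Variation of constants, in differential form.  For [u] in the domain, the
    curve [phi s = T (t - s) (pi0 (S s u))] joins [T t (pi0 u)] to
    [pi0 (S t u)].  Its increment on [[s, s + h]] is [T (t - s - h)] applied to
    [pi0 (S (s + h) u) - T h (pi0 (S s u))]; there the [A] terms cancel and
    [h * delta0 (pi1 (S s u))] remains to first order, which is bounded by
    [h] times the norm of [pi1 u]. *)
Lemma driven_component (pi0 : Z -> E) (pi1 : Z -> C0 R E) (K c : R) :
  linear pi0 -> (forall u, `|pi0 u| <= `|u|) ->
  linear pi1 -> (forall u, `|pi1 u| <= `|u|) ->
  (forall u, dom B u -> C01 (pi1 u) /\ pi1 (act B u) = deriv_C0 (pi1 u)) ->
  (forall u, dom B u ->
    dom A (pi0 u) /\ pi0 (act B u) = act A (pi0 u) + delta0 (pi1 u)) ->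
  0 <= K -> 0 <= c ->
  (forall (t : R) x, 0 <= t -> `|T t x| <= K * expR (c * t) * `|x|) ->
  forall u (t : R), 0 <= t ->
    `|pi0 (S t u) - T t (pi0 u)| <= t * (K * expR (c * t)) * `|pi1 u|.
Proof.
move=> l0 n0 l1 n1 shift drive K0 c0 TK u t t0.
pose G := K * expR (c * t).
have G0 : 0 <= G by rewrite mulr_ge0// expR_ge0.
have TG s x : 0 <= s <= t -> `|T s x| <= G * `|x|.
  move=> /andP[s0 st]; apply: le_trans (TK s x s0) _.
  by rewrite ler_wpM2r// ler_wpM2l// ler_expR ler_wpM2l.
have [L L0 SL] := semigroup_linear_bound sgS t0.
have lS := semigroup_linear sgS t0; have lT := semigroup_linear sgT t0.
apply: (@dense_le (fun u => `|pi0 (S t u) - T t (pi0 u)|)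
  (fun u => t * G * `|pi1 u|) (L + G + t * G)).
- by rewrite !addr_ge0// mulr_ge0.
- move=> {}u v; rewrite -[pi0 (S t u) - _](subrK (pi0 (S t v) - T t (pi0 v))).
  rewrite addrC; apply: le_trans (ler_normD _ _) _; rewrite lerD2l.
  have -> : pi0 (S t u) - T t (pi0 u) - (pi0 (S t v) - T t (pi0 v)) =
      pi0 (S t (u - v)) - T t (pi0 (u - v)).
    rewrite (linear_mapB lS) !(linear_mapB l0) (linear_mapB lT).
    by linear_comb.
  apply: le_trans (ler_normB _ _) _.
  have := le_trans (n0 _) (SL (u - v)).
  have := TG t (pi0 (u - v)) ltac:(lra).
  have : G * `|pi0 (u - v)| <= G * `|u - v| by rewrite ler_wpM2l.
  have : 0 <= t * G * `|u - v| by rewrite !mulr_ge0.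
  lra.
- move=> {}u v; apply: (@le_trans _ _ (t * G * (`|pi1 u| + `|u - v|))).
    rewrite ler_wpM2l ?mulr_ge0// -[pi1 v](subrK (pi1 u)) addrC.
    apply: le_trans (ler_normD _ _) _.
    by rewrite lerD2l -(linear_mapB l1) distrC.
  rewrite mulrDr lerD2l ler_wpM2r//; lra.
move=> {}u Bu; pose phi s := T (t - s) (pi0 (S s u)).
have -> : pi0 (S t u) - T t (pi0 u) = phi t - phi 0.
  by rewrite /phi subrr subr0 (semigroup0 sgT) (semigroup0 sgS).
rewrite -mulrA mulrC -[X in _ * X]subr0.
apply: mean_value_inequality => //; first by rewrite mulr_ge0.
- move=> s st e e0.
  have e30 : 0 < e / 2 by apply: divr_gt0.
  have eG : 0 < e / 2 / (G + 1) by apply: divr_gt0 => //; lra.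
  have [d1 d10 H1] := semigroup_orbit_continuous sgS u (lexx 0) st eG.
  have ts : 0 <= t - s <= t by lra.
  have [d2 d20 H2] := semigroup_orbit_continuous sgT (pi0 (S s u)) (lexx 0) ts e30.
  exists (Num.min d1 d2); first by rewrite lt_min d10.
  move=> r rt; rewrite le_min => /andP[rs1 rs2].
  have tr : 0 <= t - r by lra.
  have -> : phi r - phi s = T (t - r) (pi0 (S r u - S s u)) +
      (T (t - r) (pi0 (S s u)) - T (t - s) (pi0 (S s u))).
    rewrite (linear_mapB l0) (linear_mapB (semigroup_linear sgT tr)) /phi.
    by linear_comb.
  apply: le_trans (ler_normD _ _) _.
  have := H2 (t - r) ltac:(lra); rewrite (_ : t - r - (t - s) = s - r); last ring.
  rewrite (distrC s) => /(_ rs2) {}H2.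
  have := TG (t - r) (pi0 (S r u - S s u)) ltac:(lra).
  have := le_trans (n0 (S r u - S s u)) (H1 r rt rs1).
  move=> H3 H4; have := ler_wpM2l G0 H3.
  have := mul_div_succ_le G0 (ltW e30).
  lra.
move=> s st e e0; have s0 : 0 <= s by lra.
have [Bs _] := generator_orbit sgS genB s0 Bu.
have [As drives] := drive _ Bs.
have eG : 0 < e / 2 / (G + 1) by apply: divr_gt0 => //; lra.
have [d1 d10 H1] := orbit_derivative Bu s0 eG.
have [d2 d20 H2] := generator_derivative genA As eG.
exists (Num.min d1 d2); first by rewrite lt_min d10.
move=> h /andP[h0]; rewrite le_min => /andP[hd1 hd2] sht.
have {}H1 := H1 h ltac:(lra); have {}H2 := H2 h ltac:(lra).
have tsh : 0 <= t - (s + h) by lra.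
have h0' : 0 <= h by lra.
have -> : phi (s + h) - phi s = T (t - (s + h))
    (pi0 (S (s + h) u - S s u - h *: act B (S s u)) -
     (T h (pi0 (S s u)) - pi0 (S s u) - h *: act A (pi0 (S s u))) +
     h *: delta0 (pi1 (S s u))).
  rewrite /phi (_ : t - s = t - (s + h) + h); last ring.
  rewrite (@semigroupD _ _ _ sgT _ h)// -(linear_mapB (semigroup_linear sgT tsh)).
  congr (T _ _); rewrite !(linear_mapB l0) (linear_mapZ l0) drives.
  by linear_comb.
apply: le_trans (TG _ _ _) _; first lra.
have H3 : `|delta0 (pi1 (S s u))| <= `|pi1 u|.
  apply: le_trans (le_sup_norm _ _) _.
  exact: shift_component_le.
set x := pi0 _ - _ + _.
have Hx : `|x| <= 2 * (e / 2 / (G + 1) * h) + h * `|pi1 u|.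
  apply: le_trans (ler_normD _ _) _; rewrite normrZ (gtr0_norm h0).
  apply: lerD; last by rewrite ler_wpM2l.
  apply: le_trans (ler_normB _ _) _.
  by have := le_trans (n0 _) H1; lra.
apply: le_trans (ler_wpM2l G0 Hx) _.
have e20 : 0 <= e / 2 by apply: divr_ge0 => //; exact: ltW.
move: (ler_wpM2r h0' (mul_div_succ_le G0 e20)); lra.
Qed.

End components.

(** * Symmetrized products: consistency and stability *)

Section iterates.
Context {R : realType} {X : normedModType R}.
Implicit Types (V : X -> X).

Lemma linear_iter V (n : nat) : linear V -> linear (iter n V).
Proof. by move=> lV; elim: n => [|n IH] a x y; rewrite ?iterS ?IH ?lV. Qed.

(** Telescoping: [iter (n - k) V (x k)] goes from [iter n V (x 0)] to [x n] as
    [k] grows, and each step moves it by a power of [V] applied to the defect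
    [x k.+1 - V (x k)]. *)
Lemma iter_defect_le V (x : nat -> X) (n : nat) (M e : R) : linear V ->
  (forall (k : nat) y, (k < n)%N -> `|iter k V y| <= M * `|y|) ->
  (forall k : nat, (k < n)%N -> `|x k.+1 - V (x k)| <= e) ->
  0 <= M ->
  `|x n - iter n V (x 0%N)| <= n%:R * (M * e).
Proof.
move=> lV VM xe M0.
suff main k : (k <= n)%N ->
    `|iter (n - k) V (x k) - iter n V (x 0%N)| <= k%:R * (M * e).
  by have := main n (leqnn n); rewrite subnn.
elim: k => [_|k IH kn]; first by rewrite subn0 subrr normr0 mul0r.
have := IH (ltnW kn); rewrite -{1}(subnSK kn) iterSr => H.
rewrite -[_ - _](subrKA (iter (n - k.+1) V (V (x k)))).
apply: le_trans (ler_normD _ _) _.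
rewrite -(linear_mapB (linear_iter _ lV)) -natr1 mulrDl mul1r addrC.
apply: lerD => //.
apply: le_trans (VM _ _ _) _; first by rewrite ltn_subrL (leq_trans _ kn).
by rewrite ler_wpM2l// xe.
Qed.

Lemma opnorm_le V (C : R) : 0 <= C -> (forall x, `|V x| <= C * `|x|) ->
  (opnorm V <= C%:E)%E.
Proof.
move=> C0 VC; apply: ge_ereal_sup => _ [x /= x1 <-]; rewrite lee_fin.
by apply: le_trans (VC x) _; rewrite ler_piMr.
Qed.

Lemma le_opnorm V (C : R) : linear V -> (opnorm V <= C%:E)%E ->
  forall x, `|V x| <= C * `|x|.
Proof.
move=> lV VC x; rewrite -[C]divr1; apply: linear_bound_of_ball => // y y1.
by rewrite -lee_fin; apply: le_trans VC; apply: ereal_sup_ubound; exists y.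
Qed.

(** The average of the two orders of one time step; the symmetrized product is
    an iterate of it. *)
Definition symmetrized_step (S1 S2 : R -> X -> X) (h : R) (x : X) : X :=
  2^-1 *: (S1 h (S2 h x) + S2 h (S1 h x)).

Lemma linear_symmetrized_step (S1 S2 : R -> X -> X) (h : R) :
  linear (S1 h) -> linear (S2 h) -> linear (symmetrized_step S1 S2 h).
Proof.
move=> l1 l2 a x y; rewrite /symmetrized_step l2 l1 l1 l2; linear_comb.
Qed.

Lemma symmetrized_productE (S1 S2 : R -> X -> X) (t : R) (n : nat) (x : X) :
  linear (S1 (t / n%:R)) -> linear (S2 (t / n%:R)) ->
  symmetrized_product S1 S2 t n x = iter n (symmetrized_step S1 S2 (t / n%:R)) x.
Proof.
rewrite /symmetrized_product; move: (t / n%:R) => h l1 l2.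
elim: n => [|n IH]; first by rewrite expr0 invr1 scale1r.
rewrite !iterS -IH /symmetrized_step !(linear_mapZ l1, linear_mapZ l2).
by rewrite -scalerDr scalerA exprS invfM.
Qed.

End iterates.

Section symmetrized_consistency.
Context {R : realType} {X : normedModType R}.

(** The product rule at [0]; the local bound [L] controls the image under [S1 h]
    of the first order remainder of [S2 h x], and conversely. *)
Lemma symmetrized_step_derivative (B1 B2 : operator X) (S1 S2 : R -> X -> X)
    (L : R) : generates B1 S1 -> generates B2 S2 -> 0 <= L ->
  (forall (h : R) x, 0 <= h <= 1 -> `|S1 h x| <= L * `|x|) ->
  (forall (h : R) x, 0 <= h <= 1 -> `|S2 h x| <= L * `|x|) ->
  forall x, dom B1 x -> dom B2 x ->
  forall e : R, 0 < e -> exists2 d : R, 0 < d & forall h : R, 0 < h <= d ->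
    `|symmetrized_step S1 S2 h x - x - h *: (act B1 x + act B2 x)| <= e * h.
Proof.
move=> gB1 gB2 L0 S1L S2L x B1x B2x e e0.
have half (B B' : operator X) (S S' : R -> X -> X) : generates B S ->
    generates B' S' -> (forall (h : R) x, 0 <= h <= 1 -> `|S h x| <= L * `|x|) ->
    dom B x -> dom B' x -> exists2 d : R, 0 < d & forall h : R, 0 < h <= d ->
    `|S h (S' h x) - x - h *: (act B x + act B' x)| <= e * h.
  move=> [sgS gS] [sgS' gS'] SL Bx B'x.
  have eL : 0 < e / (L + 2) by apply: divr_gt0 => //; lra.
  have [d1 d10 H1] := generator_derivative gS Bx eL.
  have [d2 d20 H2] := generator_derivative gS' B'x eL.
  have [d3 d30 H3] := orbit_right_continuous sgS (act B' x) eL.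
  exists (Num.min 1 (Num.min d1 (Num.min d2 d3))).
    by rewrite !lt_min ltr01 d10 d20.
  move=> h /andP[h0]; rewrite !le_min => /and4P[h1 hd1 hd2 hd3].
  have {}H1 := H1 h ltac:(lra); have {}H2 := H2 h ltac:(lra).
  have {}H3 := H3 h ltac:(lra).
  have lS : linear (S h) by apply: (semigroup_linear sgS); lra.
  rewrite (_ : _ - _ - _ = S h (S' h x - x - h *: act B' x) +
    (S h x - x - h *: act B x) + h *: (S h (act B' x) - act B' x)); last first.
    by rewrite !(linear_mapB lS) (linear_mapZ lS); linear_comb.
  apply: le_trans (ler_normD _ _) _.
  apply: le_trans (lerD (ler_normD _ _) (lexx _)) _.
  rewrite normrZ (gtr0_norm h0).
  have H4 := le_trans (SL h _ ltac:(lra)) (ler_wpM2l L0 H2).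
  apply: le_trans (lerD (lerD H4 H1) (ler_wpM2l (ltW h0) H3)) _.
  by rewrite (_ : e * h = (L + 2) * (e / (L + 2) * h)); [lra|field; lra].
have [d1 d10 H1] := half _ _ _ _ gB1 gB2 S1L B1x B2x.
have [d2 d20 H2] := half _ _ _ _ gB2 gB1 S2L B2x B1x.
exists (Num.min d1 d2); first by rewrite lt_min d10.
move=> h /andP[h0]; rewrite le_min => /andP[hd1 hd2].
have {}H1 := H1 h ltac:(lra); have {}H2 := H2 h ltac:(lra).
rewrite (_ : _ - _ - _ =
  2^-1 *: ((S1 h (S2 h x) - x - h *: (act B1 x + act B2 x)) +
           (S2 h (S1 h x) - x - h *: (act B2 x + act B1 x)))); last first.
  by rewrite /symmetrized_step; linear_comb.
rewrite normrZ ger0_norm ?invr_ge0//.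
by have := ler_normD (S1 h (S2 h x) - x - h *: (act B1 x + act B2 x))
  (S2 h (S1 h x) - x - h *: (act B2 x + act B1 x)); lra.
Qed.

End symmetrized_consistency.

Section symmetrized_stability.
Context {R : realType} {E D Z : normedModType R}.
Variables (pE : Z -> E) (pD : Z -> D).
Hypotheses (pE_linear : linear pE) (pD_linear : linear pD).
Hypotheses (pE_le : forall u, `|pE u| <= `|u|) (pD_le : forall u, `|pD u| <= `|u|).
Hypothesis pED_le : forall u, `|u| <= `|pE u| + `|pD u|.

(** Abstract form of the triangular structure: [pD] is not increased and [pE]
    follows [T] up to an error that is linear in time and in the norm of [pD]. *)
Definition driven_by (K c : R) (T : R -> E -> E) (S : R -> Z -> Z) :=
  forall (t : R) (u : Z), 0 <= t ->
    `|pE (S t u) - T t (pE u)| <= t * (K * expR (c * t)) * `|pD u| /\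
    `|pD (S t u)| <= `|pD u|.

Variables (T1 T2 : R -> E -> E) (S1 S2 : R -> Z -> Z) (K c : R).
Hypotheses (K1 : 1 <= K) (c0 : 0 <= c).
Hypotheses (T1_linear : forall t : R, 0 <= t -> linear (T1 t))
  (T2_linear : forall t : R, 0 <= t -> linear (T2 t)).
Hypotheses (S1_linear : forall t : R, 0 <= t -> linear (S1 t))
  (S2_linear : forall t : R, 0 <= t -> linear (S2 t)).
Hypotheses (T1K : forall (t : R) x, 0 <= t -> `|T1 t x| <= K * expR (c * t) * `|x|)
  (T2K : forall (t : R) x, 0 <= t -> `|T2 t x| <= K * expR (c * t) * `|x|).
Hypotheses (S1d : driven_by K c T1 S1) (S2d : driven_by K c T2 S2).

Lemma driven_local_bound (T : R -> E -> E) (S : R -> Z -> Z) :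
  (forall (t : R) x, 0 <= t -> `|T t x| <= K * expR (c * t) * `|x|) ->
  driven_by K c T S ->
  forall (h : R) u, 0 <= h <= 1 -> `|S h u| <= (2 * (K * expR c) + 1) * `|u|.
Proof.
have K0 : 0 <= K := le_trans ler01 K1.
move=> TK Sd h u /andP[h0 h1]; have [S1e S1p] := Sd h u h0.
apply: le_trans (pED_le _) _.
have := TK h (pE u) h0.
have : K * expR (c * h) <= K * expR c.
  apply: ler_wpM2l; first lra.
  by rewrite ler_expR ler_piMr.
have Ke : 0 <= K * expR (c * h) by rewrite mulr_ge0 ?expR_ge0//; lra.
set G := K * expR (c * h) in S1e Ke *; set G' := K * expR c => GG' TG.
have H1 : h * G * `|pD u| <= G' * `|u|.
  have hG : h * G <= G' by apply: le_trans GG'; rewrite ler_piMl.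
  by rewrite ler_pM// mulr_ge0.
have H2 : G * `|pE u| <= G' * `|u| by rewrite ler_pM.
have H3 := pD_le u.
have H4 := ler_normD (pE (S h u) - T h (pE u)) (T h (pE u)).
rewrite subrK in H4; lra.
Qed.

(** The triangular structure survives composition; the factor [K ^+ 2] and the
    exponent [2 * c] come from bounding both [h * G] and [G * (h * G)] by
    [h * G ^+ 2], where [G = K * expR (c * h) >= 1] bounds [T1 h] and [T2 h]. *)
Lemma symmetrized_step_driven (h : R) (u : Z) : 0 <= h ->
  `|pE (symmetrized_step S1 S2 h u) - symmetrized_step T1 T2 h (pE u)| <=
    h * (2 * K ^+ 2 * expR (2 * c * h)) * `|pD u| /\
  `|pD (symmetrized_step S1 S2 h u)| <= `|pD u|.
Proof.
have K0 : 0 <= K := le_trans ler01 K1.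
move=> h0; set G := K * expR (c * h).
have G1 : 1 <= G.
  rewrite -[1]mulr1 ler_pM// -expR0 ler_expR mulr_ge0//.
have half (T T' : R -> E -> E) (S S' : R -> Z -> Z) : linear (T h) ->
    (forall x, `|T h x| <= G * `|x|) ->
    driven_by K c T S -> driven_by K c T' S' ->
    `|pE (S h (S' h u)) - T h (T' h (pE u))| <= h * (2 * G ^+ 2) * `|pD u| /\
    `|pD (S h (S' h u))| <= `|pD u|.
  move=> lT TG Sd Sd'.
  have [H1 H2] := Sd h (S' h u) h0; have [H3 H4] := Sd' h u h0.
  split; last exact: le_trans H4.
  rewrite (_ : _ - _ = (pE (S h (S' h u)) - T h (pE (S' h u))) +
    T h (pE (S' h u) - T' h (pE u))); last by rewrite (linear_mapB lT); linear_comb.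
  apply: le_trans (ler_normD _ _) _.
  have hG : 0 <= h * G by rewrite mulr_ge0//; lra.
  have G0 : 0 <= G by lra.
  have H5 : h * G * `|pD (S' h u)| <= h * G * `|pD u| by rewrite ler_wpM2l.
  have H6 := le_trans (TG _) (ler_wpM2l G0 H3).
  have H7 : h * G * `|pD u| <= G * (h * G * `|pD u|).
    by rewrite ler_peMl// mulr_ge0.
  by apply: le_trans (lerD (le_trans H1 H5) H6) _; rewrite -/G; lra.
have -> : 2 * K ^+ 2 * expR (2 * c * h) = 2 * G ^+ 2.
  by rewrite (_ : 2 * c * h = c * h + c * h); [rewrite expRD /G|]; ring.
have [H1 H2] := half _ _ _ _ (T1_linear h0) (fun x => T1K x h0) S1d S2d.
have [H3 H4] := half _ _ _ _ (T2_linear h0) (fun x => T2K x h0) S2d S1d.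
rewrite /symmetrized_step (linear_mapZ pE_linear) (linear_mapD pE_linear).
rewrite (linear_mapZ pD_linear) (linear_mapD pD_linear); split.
  rewrite (_ : _ - _ = 2^-1 *: ((pE (S1 h (S2 h u)) - T1 h (T2 h (pE u))) +
    (pE (S2 h (S1 h u)) - T2 h (T1 h (pE u))))); last linear_comb.
  rewrite normrZ ger0_norm ?invr_ge0//.
  by have := ler_normD (pE (S1 h (S2 h u)) - T1 h (T2 h (pE u)))
    (pE (S2 h (S1 h u)) - T2 h (T1 h (pE u))); lra.
rewrite normrZ ger0_norm ?invr_ge0//.
by have := ler_normD (pD (S1 h (S2 h u))) (pD (S2 h (S1 h u))); lra.
Qed.

(** The [pE] components of the iterates of the step on [Z] form an approximate
    orbit of the stable step on [E], with defect of order [h] times the norm of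
    [u]; the [n] defects add up to order [n * h], absorbed in an exponential
    by [t <= expR t] and [h <= n * h]. *)
Lemma symmetrized_stability (M' w : R) : 1 <= M' -> 0 <= w ->
  (forall (h : R) (n : nat) x, 0 <= h ->
    `|iter n (symmetrized_step T1 T2 h) x| <= M' * expR (n%:R * h * w) * `|x|) ->
  exists M w' : R, [/\ 1 <= M, 0 <= w' & forall (h : R) (n : nat) u, 0 <= h ->
    `|iter n (symmetrized_step S1 S2 h) u| <= M * expR (n%:R * h * w') * `|u|].
Proof.
have K0 : 0 <= K := le_trans ler01 K1.
have c0' := c0; move=> M'1 w0 stab; exists (M' * (1 + 2 * K ^+ 2) + 1), (w + 2 * c + 1).
have KK : 0 <= 2 * K ^+ 2 by rewrite mulr_ge0// sqr_ge0.
split; [nra|lra|move=> h n u h0].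
set V := symmetrized_step S1 S2 h; set W := symmetrized_step T1 T2 h.
have lW : linear W.
  by apply: linear_symmetrized_step; [exact: T1_linear|exact: T2_linear].
have [->|n0] := posnP n.
  by rewrite !mul0r expR0 mulr1 /= ler_peMl//; nra.
have pDV k : `|pD (iter k V u)| <= `|u|.
  elim: k => [|k IH]; first exact: pD_le.
  by rewrite iterS (le_trans _ IH)//; have [] := symmetrized_step_driven (iter k V u) h0.
set t := n%:R * h.
have t0 : 0 <= t by rewrite mulr_ge0.
have ht : h <= t by rewrite ler_peMl// ler1n.
set C := 2 * K ^+ 2 * expR (2 * c * h).
have C0 : 0 <= C by rewrite mulr_ge0// expR_ge0.
have N0 : 0 <= M' * expR (t * w) by rewrite mulr_ge0 ?expR_ge0//; lra.
have := @iter_defect_le _ _ W (fun k => pE (iter k V u)) n (M' * expR (t * w))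
  (h * C * `|u|) lW.
move=> /(_ _ _ N0) H.
have {}H : `|pE (iter n V u) - iter n W (pE u)| <=
    n%:R * (M' * expR (t * w) * (h * C * `|u|)).
  apply: H => [k y kn|k kn].
    apply: le_trans (stab h k y h0) _; rewrite ler_wpM2r// ler_wpM2l//; first lra.
    by rewrite ler_expR ler_wpM2r// ler_wpM2r// ler_nat ltnW.
  rewrite iterS; have [H _] := symmetrized_step_driven (iter k V u) h0.
  by apply: le_trans H _; rewrite ler_wpM2l// mulr_ge0.
apply: le_trans (pED_le _) _.
have H1 := pDV n.
have H2 : `|iter n W (pE u)| <= M' * expR (t * w) * `|u|.
  by apply: le_trans (stab h n _ h0) _; rewrite ler_wpM2l.
have H3 := ler_normD (pE (iter n V u) - iter n W (pE u)) (iter n W (pE u)).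
rewrite subrK in H3.
have Ct : h * C * n%:R <= expR t * (2 * K ^+ 2 * expR (2 * c * t)).
  rewrite (_ : h * C * n%:R = t * C); last by rewrite /t; ring.
  apply: ler_pM => //; first by have := expR_ge1Dx t; lra.
  by rewrite ler_wpM2l// ler_expR ler_wpM2l//; lra.
set e1 := expR (t * w) in N0 H H2 *; set e2 := expR t in Ct *.
set e3 := expR (2 * c * t) in Ct *.
have -> : expR (t * (w + 2 * c + 1)) = e1 * e2 * e3.
  by rewrite /e1 /e2 /e3 -!expRD; congr expR; ring.
have e1_1 : 1 <= e1 by rewrite -expR0 ler_expR mulr_ge0.
have e2_1 : 1 <= e2 by rewrite -expR0 ler_expR.
have e3_1 : 1 <= e3 by rewrite -expR0 ler_expR !mulr_ge0.
have e23 : 1 <= e2 * e3 by rewrite -[1]mulr1 ler_pM.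
have e123 : e1 <= e1 * e2 * e3 by rewrite -mulrA ler_peMr//; lra.
have H4 : n%:R * (M' * e1 * (h * C * `|u|)) <=
    M' * e1 * (e2 * (2 * K ^+ 2 * e3)) * `|u|.
  rewrite (_ : n%:R * _ = M' * e1 * (h * C * n%:R) * `|u|); last ring.
  by rewrite ler_wpM2r// ler_wpM2l.
have H5 : M' * e1 * `|u| <= M' * (e1 * e2 * e3) * `|u|.
  by rewrite ler_wpM2r// ler_wpM2l//; lra.
have H6 : `|u| <= e1 * e2 * e3 * `|u| by rewrite ler_peMl//; lra.
lra.
Qed.

End symmetrized_stability.

(** * The product formula for a core that need not be invariant *)

Section product_formula.
Context {R : realType} {X : normedModType R}.

Lemma closure_approx (A B : operator X) (y : X) (e : R) : is_closure A B ->
  dom A y -> 0 < e ->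
  exists z, [/\ dom B z, `|z - y| <= e & `|act B z - act A y| <= e].
Proof.
move=> AB Ay e0.
have : closure (graph B) (y, act A y) by rewrite -AB.
move=> /(_ _ (nbhsx_ballx (y, act A y) _ e0)) [[z Bz] [[/= domz ->]]].
rewrite /ball/= /prod_ball/= -!ball_normE /ball_/= => -[H1 H2].
by exists z; split=> //; rewrite distrC ltW.
Qed.

(** A common step size for finitely many properties that hold for all small
    steps. *)
Lemma common_radius (P : nat -> R -> Prop) (n : nat) :
  (forall j, exists2 d : R, 0 < d & forall h : R, 0 < h <= d -> P j h) ->
  exists2 d : R, 0 < d & forall j (h : R), (j < n)%N -> 0 < h <= d -> P j h.
Proof.
move=> HP; elim: n => [|n [d d0 Hd]]; first by exists 1.
have [d' d'0 Hd'] := HP n; exists (Num.min d d'); first by rewrite lt_min d0.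
move=> j h; rewrite ltnS leq_eqVlt le_min => /orP[/eqP->|jn] /and3P[h0 hd hd'].
  by apply: Hd'; rewrite h0.
by apply: Hd => //; rewrite h0.
Qed.

(** The orbit [T r x] is a primitive of [T r (A x)]. *)
Lemma orbit_increment (A : operator X) (T : R -> X -> X) (x v : X) (a b C : R) :
  strongly_continuous_semigroup T -> is_generator A T -> dom A x ->
  0 <= a <= b -> (forall r : R, a <= r <= b -> `|T r (act A x) - v| <= C) ->
  `|T b x - T a x - (b - a) *: v| <= C * (b - a).
Proof.
move=> sgT genA Ax ab TC.
have C0 : 0 <= C by apply: le_trans (normr_ge0 _) (TC a _); lra.
pose f r := T r x - (r - a) *: v.
rewrite (_ : _ - _ - _ = f b - f a); last first.
  by rewrite /f subrr scale0r subr0; linear_comb.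
apply: mean_value_inequality => //; first lra.
  move=> s sab e e0; have e20 : 0 < e / 2 by lra.
  have a0 : 0 <= a by lra.
  have [d1 d10 H1] := semigroup_orbit_continuous sgT x a0 sab e20.
  have d20 : 0 < e / 2 / (`|v| + 1).
    by apply: divr_gt0 => //; apply: ltr_wpDl.
  exists (Num.min d1 (e / 2 / (`|v| + 1))); first by rewrite lt_min d10.
  move=> r rab; rewrite le_min => /andP[rs1 rs2].
  rewrite (_ : f r - f s = (T r x - T s x) - (r - s) *: v); last first.
    by rewrite /f; linear_comb.
  apply: le_trans (ler_normB _ _) _; rewrite normrZ.
  have H2 := H1 r rab rs1.
  have : `|r - s| * `|v| <= e / 2 / (`|v| + 1) * (`|v| + 1).
    by apply: ler_pM => //; lra.
  rewrite divfK; first lra.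
  by rewrite gt_eqF// ltr_wpDl.
move=> s sab e e0; have s0 : 0 <= s by lra.
have [_ As] := generator_orbit sgT genA s0 Ax.
have [d d0 Hd] := orbit_derivative sgT genA Ax s0 e0.
exists d => // h hd shb; have {}Hd := Hd h hd.
rewrite (_ : f (s + h) - f s = (T (s + h) x - T s x - h *: act A (T s x)) +
  h *: (act A (T s x) - v)); last by rewrite /f; linear_comb.
apply: le_trans (ler_normD _ _) _; rewrite normrZ gtr0_norm; last lra.
have := TC s ltac:(lra); rewrite -As => HC.
have h0 : 0 <= h by lra.
by have := ler_wpM2l h0 HC; lra.
Qed.

Variables (V : R -> X -> X) (B A : operator X) (T : R -> X -> X) (M w : R).
Hypotheses (V_linear : forall h : R, 0 <= h -> linear (V h))
  (V_stable : forall (h : R) (n : nat) x, 0 <= h ->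
    `|iter n (V h) x| <= M * expR (n%:R * h * w) * `|x|)
  (V_consistent : forall x, dom B x -> forall e : R, 0 < e ->
    exists2 d : R, 0 < d & forall h : R, 0 < h <= d ->
      `|V h x - x - h *: act B x| <= e * h).
Hypotheses (M0 : 0 <= M) (w0 : 0 <= w).
Hypotheses (AB : is_closure A B) (sgT : strongly_continuous_semigroup T)
  (genA : is_generator A T).

(** The curve is the polygon through vectors [z j] of [dom B] close to
    [T (j * tau) x] in the graph norm.  The step size [tau] is fixed first, so
    that [v s = T s (A x)] oscillates by at most [e] over two steps; only then
    are the [z j] chosen, with accuracy [e * tau], so that the slopes of the
    polygon are within [3 * e] of [v].  Every point of the polygon is a convex
    combination of two nodes, and consistency is uniform over the finitely many
    nodes involved. *)
Lemma approximate_solution (x : X) (t e : R) : 0 < t -> 0 < e -> dom A x ->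
  exists u : R -> X, [/\ `|u 0 - x| <= e, `|u t - T t x| <= e &
    exists2 d : R, 0 < d & forall a h : R, 0 <= a -> 0 < h <= d -> a + h <= t ->
      `|V h (u a) - u (a + h)| <= 6 * e * h].
Proof.
move=> t0 e0 Ax; pose v s := T s (act A x).
have t20 : 0 <= 2 * t by lra.
have [eta eta0 v_unif] := continuous_between_uniform t20
  (semigroup_orbit_continuous sgT (act A x) (lexx 0) (b := 2 * t)) e0.
have eta_t : 0 < eta / 2 / t by apply: divr_gt0 => //; lra.
have [m /(_ m (leqnn m)) m_eta] := exists_invS_le eta_t.
pose tau := t / m.+1%:R.
have tau0 : 0 < tau by apply: divr_gt0.
have tau_eta : 2 * tau <= eta.
  have := ler_wpM2l (ltW t0) m_eta.
  by rewrite -/tau mulrCA divff ?mulr1 ?gt_eqF//; lra.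
have tau_t : m.+1%:R * tau = t by rewrite /tau mulrCA divff ?mulr1.
have tau_le : tau <= t.
  by rewrite -[leRHS]tau_t ler_peMl ?(ltW tau0)// ler1n.
have jtau (j : nat) : 0 <= j%:R * tau by rewrite mulr_ge0// ltW.
have /choice[z zP] : forall j : nat, exists zj, [/\ dom B zj,
    `|zj - T (j%:R * tau) x| <= Num.min e (e * tau) &
    `|act B zj - v (j%:R * tau)| <= e].
  move=> j; have mine : 0 < Num.min e (e * tau) by rewrite lt_min e0 mulr_gt0.
  have [Aj Ajx] := generator_orbit sgT genA (jtau j) Ax.
  have [zj [H1 H2 H3]] := closure_approx AB Aj mine.
  exists zj; split=> //; rewrite /v -Ajx; apply: le_trans H3 _.
  by rewrite ge_min lexx.
have [d d0 Hd] := common_radius m.+2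
  (fun j => V_consistent (let: And3 Bz _ _ := zP j in Bz) e0).
pose u := polygon tau z.
exists u; split.
- rewrite /u polygon0//; have [_ + _] := zP 0%N; rewrite mul0r (semigroup0 sgT).
  by rewrite le_min => /andP[].
- rewrite /u -tau_t polygon_node//; have [_ + _] := zP m.+1.
  by rewrite le_min => /andP[].
exists (Num.min d tau); first by rewrite lt_min d0.
move=> a h a0 /andP[h0]; rewrite le_min => /andP[hd htau] aht.
have h0' : 0 <= h by lra.
have slope : `|u (a + h) - u a - (a + h - a) *: v a| <= 3 * e * (a + h - a).
  apply: polygon_slope => //; first lra.
  move=> j aj jah.
  have jS : j.+1%:R * tau = j%:R * tau + tau by rewrite -natr1 mulrDl mul1r.
  have jSt : j.+1%:R * tau - j%:R * tau = tau by lra.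
  have j0 := jtau j.
  have := @orbit_increment A T x (v a) (j%:R * tau) (j.+1%:R * tau) e sgT genA Ax.
  rewrite jSt => /(_ ltac:(lra)) incr.
  have {}incr : `|T (j.+1%:R * tau) x - T (j%:R * tau) x - tau *: v a| <= e * tau.
    by apply: incr => r jr; apply: v_unif; try lra; rewrite ler_norml; lra.
  have [_ + _] := zP j; rewrite le_min => /andP[_ zj].
  have [_ + _] := zP j.+1; rewrite le_min => /andP[_ zj1].
  rewrite (_ : z j.+1 - z j - _ = (z j.+1 - T (j.+1%:R * tau) x) -
    (z j - T (j%:R * tau) x) +
    (T (j.+1%:R * tau) x - T (j%:R * tau) x - tau *: v a)); last linear_comb.
  apply: le_trans (ler_normD _ _) _.
  by apply: le_trans (lerD (le_trans (ler_normB _ _) (lerD zj1 zj)) incr) _; lra.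
have [j /andP[ja aj]] := exists_cell tau0 a0.
have jm : (j < m.+1)%N.
  by rewrite -(ltr_nat R) -(ltr_pM2r tau0) tau_t; lra.
have jS : j.+1%:R * tau = j%:R * tau + tau by rewrite -natr1 mulrDl mul1r.
have j0 := jtau j.
have Bz i : (i < m.+2)%N -> `|i%:R * tau - a| <= tau ->
    `|V h (z i) - z i - h *: v a| <= 3 * e * h.
  move=> im ia; have i0 := jtau i.
  have it : i%:R * tau <= 2 * t.
    by move: ia; rewrite ler_norml; lra.
  have [_ _ H1] := zP i; have H2 := Hd i h im ltac:(lra).
  have H3 : `|v (i%:R * tau) - v a| <= e by apply: v_unif; lra.
  rewrite (_ : _ - _ - _ = (V h (z i) - z i - h *: act B (z i)) +
    h *: ((act B (z i) - v (i%:R * tau)) + (v (i%:R * tau) - v a))); last first.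
    linear_comb.
  apply: le_trans (ler_normD _ _) _; rewrite normrZ (gtr0_norm h0).
  have := ler_wpM2l h0' (le_trans (ler_normD _ _) (lerD H1 H3)).
  by move=> H4; apply: le_trans (lerD H2 H4) _; lra.
pose th := a / tau - j%:R.
have th01 : 0 <= th <= 1.
  rewrite /th subr_ge0 ler_pdivlMr// ja/= lerBlDl ler_pdivrMr//.
  by rewrite natr1 ltW.
have uE : u a = (1 - th) *: z j + th *: z j.+1.
  by rewrite /u (@polygonE _ _ _ _ j)// ?ja ?ltW// -/th; linear_comb.
rewrite (_ : V h (u a) - u (a + h) = ((1 - th) *: (V h (z j) - z j - h *: v a) +
    th *: (V h (z j.+1) - z j.+1 - h *: v a)) -
    (u (a + h) - u a - (a + h - a) *: v a)); last first.
  rewrite uE (linear_mapD (V_linear h0')) !(linear_mapZ (V_linear h0')).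
  linear_comb.
have H1 := Bz j (ltnW jm) ltac:(rewrite ler_norml; lra).
have H2 := Bz j.+1 jm ltac:(rewrite ler_norml; lra).
have thc0 : 0 <= 1 - th by lra.
have th0 : 0 <= th by lra.
apply: le_trans (ler_normB _ _) _.
apply: le_trans (lerD (ler_normD _ _) slope) _.
rewrite !normrZ (ger0_norm th0) (ger0_norm thc0).
apply: le_trans (lerD (lerD (ler_wpM2l thc0 H1) (ler_wpM2l th0 H2)) (lexx _)) _.
lra.
Qed.

(** The approximate solution is compared with the discrete evolution started at
    the same point: [n] defects of size [6 * e * h] give [6 * e * t]. *)
Lemma product_formula_dom (x : X) (t : R) : 0 < t -> dom A x ->
  forall e : R, 0 < e -> exists N : nat, forall n, (N <= n)%N ->
    `|iter n (V (t / n%:R)) x - T t x| <= e.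
Proof.
move=> t0 Ax e0 e00; pose Mt := M * expR (t * w).
have Mt0 : 0 <= Mt by rewrite mulr_ge0// expR_ge0.
have Mtt : 0 <= Mt * t by rewrite mulr_ge0// ltW.
have den : 0 < Mt + 6 * (Mt * t) + 1 by lra.
pose e := e0 / (Mt + 6 * (Mt * t) + 1).
have e_gt0 : 0 < e by apply: divr_gt0.
have [u [u0 ut [d d0 Hd]]] := approximate_solution t0 e_gt0 Ax.
have dt : 0 < d / t by apply: divr_gt0.
have [N HN] := exists_invS_le dt.
exists N.+1 => -[//|n]; rewrite ltnS => Nn.
set h := t / n.+1%:R.
have nh : n.+1%:R * h = t by rewrite /h mulrCA divff ?mulr1.
have h0 : 0 < h by apply: divr_gt0.
have hd : h <= d.
  have := ler_wpM2l (ltW t0) (HN n Nn).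
  by rewrite -/h mulrCA divff ?mulr1 ?gt_eqF.
have V_bound k y : (k <= n.+1)%N -> `|iter k (V h) y| <= Mt * `|y|.
  move=> kn; apply: le_trans (V_stable k y (ltW h0)) _.
  rewrite ler_wpM2r// ler_wpM2l// ler_expR ler_wpM2r// -nh.
  by rewrite ler_wpM2r ?ler_nat// ltW.
have defect : `|u (n.+1%:R * h) - iter n.+1 (V h) (u (0%:R * h))| <=
    n.+1%:R * (Mt * (6 * e * h)).
  apply: (@iter_defect_le _ _ _ (fun k => u (k%:R * h))) => //.
  - exact: V_linear (ltW h0).
  - by move=> k y kn; exact: V_bound (ltnW kn).
  move=> k kn; rewrite distrC.
  have -> : k.+1%:R * h = k%:R * h + h by rewrite -natr1 mulrDl mul1r.
  apply: Hd; [by rewrite mulr_ge0// ltW|by rewrite h0|].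
  have -> : k%:R * h + h = k.+1%:R * h by rewrite -natr1 mulrDl mul1r.
  by rewrite -nh ler_wpM2r ?ler_nat// ltW.
have {}defect : `|u t - iter n.+1 (V h) (u 0)| <= 6 * (Mt * t) * e.
  move: defect; rewrite nh mul0r.
  by rewrite (_ : n.+1%:R * _ = 6 * (Mt * (n.+1%:R * h)) * e); [rewrite nh|ring].
have lV := linear_iter n.+1 (V_linear (ltW h0)).
have H1 := V_bound n.+1 (u 0 - x) (leqnn _); rewrite (linear_mapB lV) in H1.
have {}H1 := le_trans H1 (ler_wpM2l Mt0 u0).
rewrite (_ : _ - _ = (u t - T t x) - (u t - iter n.+1 (V h) (u 0)) -
  (iter n.+1 (V h) (u 0) - iter n.+1 (V h) x)); last linear_comb.
apply: le_trans (ler_normB _ _) _.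
apply: le_trans (lerD (le_trans (ler_normB _ _) (lerD ut defect)) H1) _.
have -> : e0 = (Mt + 6 * (Mt * t) + 1) * e by rewrite /e mulrCA divff ?mulr1 ?gt_eqF.
lra.
Qed.

Lemma product_formula (x : X) (t : R) : sequentially_complete X ->
  (forall x, V 0 x = x) -> 0 <= t ->
  iter n (V (t / n%:R)) x @[n --> \oo] --> T t x.
Proof.
move=> cX V0 t0; apply/cvgrPdist_le => e e0.
have [->|tn] := eqVneq t 0.
  apply: nearW => n; rewrite mul0r (semigroup0 sgT).
  have -> : iter n (V 0) x = x by elim: n => //= n ->; rewrite V0.
  by rewrite subrr normr0 ltW.
have {tn t0} t0 : 0 < t by rewrite lt_neqAle eq_sym tn.
have [L L0 TL] := semigroup_linear_bound sgT (ltW t0).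
pose Mt := M * expR (t * w).
have Mt0 : 0 <= Mt by rewrite mulr_ge0// expR_ge0.
have e20 : 0 < e / 2 by lra.
have den : 0 < Mt + L + 1 by lra.
have eML : 0 < e / 2 / (Mt + L + 1) by apply: divr_gt0.
have [y Ay xy] := dom_generator_dense sgT genA cX x eML.
have [N HN] := product_formula_dom t0 Ay e20.
exists N.+1 => // -[//|n] /= Nn; set h := t / n.+1%:R.
have h0 : 0 <= h by rewrite divr_ge0// ltW.
have nh : n.+1%:R * h = t by rewrite /h mulrCA divff ?mulr1.
have lV := linear_iter n.+1 (V_linear h0).
have H1 := V_stable n.+1 (x - y) h0; rewrite nh -/Mt (linear_mapB lV) in H1.
have H2 := TL (x - y); rewrite (linear_mapB (semigroup_linear sgT (ltW t0))) in H2.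
have H3 := HN n.+1 (ltnW Nn); rewrite -/h in H3.
rewrite -/(iter n.+1 (V h) x) distrC.
rewrite (_ : _ - _ = (iter n.+1 (V h) x - iter n.+1 (V h) y) - (T t x - T t y) +
  (iter n.+1 (V h) y - T t y)); last linear_comb.
apply: le_trans (ler_normD _ _) _.
apply: le_trans (lerD (le_trans (ler_normB _ _) (lerD H1 H2)) H3) _.
have H4 : (Mt + L) * `|x - y| <= (Mt + L + 1) * (e / 2 / (Mt + L + 1)).
  by apply: ler_pM => //; lra.
by rewrite mulrCA divff ?mulr1 ?gt_eqF// in H4; lra.
Qed.

End product_formula.

(** * Stability and convergence for the block semigroups *)

Theorem proposition3p2 (R : realType) (E : completeNormedModType R)
    (A1 A2 : operator E) (T1 T2 : R -> E -> E)
    (genT1 : generates A1 T1) (genT2 : generates A2 T2)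
    (cT1 cT2 : R -> E * C0 R E * C0 R E -> E * C0 R E * C0 R E)
    (gencT1 : generates (block_operator1 A1) cT1)
    (gencT2 : generates (block_operator2 A2) cT2)
    (M' omega' : R) (M'1 : 1 <= M') (omega'0 : 0 <= omega')
    (stable : forall (t : R) (n : nat), 0 <= t -> (0 < n)%N ->
      (opnorm (symmetrized_product T1 T2 t n) <=
         (M' * expR (t * omega'))%:E)%E) :
  (exists M omega : R, 1 <= M /\
     forall (t : R) (n : nat), 0 <= t -> (0 < n)%N ->
       (opnorm (symmetrized_product cT1 cT2 t n) <=
          (M * expR (t * omega))%:E)%E) /\
  (forall (cA : operator (E * C0 R E * C0 R E))
      (cT : R -> E * C0 R E * C0 R E -> E * C0 R E * C0 R E),
     is_closure cA (operator_add (block_operator1 A1) (block_operator2 A2)) ->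
     generates cA cT ->
     forall (x : E * C0 R E * C0 R E) (t : R), 0 <= t ->
       symmetrized_product cT1 cT2 t n x @[n --> \oo] --> cT t x).
Proof.
pose Z := (E * C0 R E * C0 R E)%type.
have cZ : sequentially_complete Z.
  apply: sequentially_complete_prod; last exact: sequentially_complete_normed.
  by apply: sequentially_complete_prod; exact: sequentially_complete_normed.
have [sgT1 gA1] := genT1; have [sgT2 gA2] := genT2.
have [sgcT1 gcA1] := gencT1; have [sgcT2 gcA2] := gencT2.
have [K1 [c1 [K11 c10 TK1]]] := semigroup_growth sgT1.
have [K2 [c2 [K21 c20 TK2]]] := semigroup_growth sgT2.
pose K := Num.max K1 K2; pose c := Num.max c1 c2.
have K_ge1 : 1 <= K by rewrite le_max K11.
have c_ge0 : 0 <= c by rewrite le_max c10.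
have K_ge0 : 0 <= K by lra.
have growth (Ki ci : R) (T : R -> E -> E) : 1 <= Ki -> Ki <= K -> ci <= c ->
    (forall (t : R) x, 0 <= t -> `|T t x| <= Ki * expR (ci * t) * `|x|) ->
    forall (t : R) x, 0 <= t -> `|T t x| <= K * expR (c * t) * `|x|.
  move=> Ki1 KiK cic TK t x t0; apply: le_trans (TK t x t0) _.
  rewrite ler_wpM2r// ler_pM ?expR_ge0//; first lra.
  by rewrite ler_expR ler_wpM2r.
have T1K : forall (t : R) x, 0 <= t -> `|T1 t x| <= K * expR (c * t) * `|x|.
  by apply: growth TK1 => //; rewrite le_max lexx.
have T2K : forall (t : R) x, 0 <= t -> `|T2 t x| <= K * expR (c * t) * `|x|.
  by apply: growth TK2 => //; rewrite le_max lexx orbT.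
pose pE (u : Z) : E := u.1.1; pose f1 (u : Z) : C0 R E := u.1.2.
pose f2 (u : Z) : C0 R E := u.2; pose pD (u : Z) := (u.1.2, u.2).
have pE_lin : linear pE by [].
have f1_lin : linear f1 by [].
have f2_lin : linear f2 by [].
have pD_lin : linear pD by [].
have pE_le u : `|pE u| <= `|u| by rewrite !prod_normE !le_max lexx.
have f1_le u : `|f1 u| <= `|u| by rewrite !prod_normE !le_max lexx orbT.
have f2_le u : `|f2 u| <= `|u| by rewrite !prod_normE !le_max lexx !orbT.
have pDE u : `|pD u| = Num.max `|f1 u| `|f2 u| by rewrite prod_normE.
have pD_le u : `|pD u| <= `|u| by rewrite pDE ge_max f1_le f2_le.
have pED_le u : `|u| <= `|pE u| + `|pD u|.
  have E0 := normr_ge0 (pE u); have D0 := normr_ge0 (pD u).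
  have f1D : `|f1 u| <= `|pD u| by rewrite pDE le_max lexx.
  have f2D : `|f2 u| <= `|pD u| by rewrite pDE le_max lexx orbT.
  rewrite !prod_normE !ge_max lerDl D0/=.
  by rewrite (le_trans f1D) ?(le_trans f2D)// lerDr.
have dense1 := dom_generator_dense sgcT1 gcA1 cZ.
have dense2 := dom_generator_dense sgcT2 gcA2 cZ.
have cT1d : driven_by pE pD K c T1 cT1.
  move=> t u t0.
  have shift v : dom (block_operator1 A1) v ->
    C01 (f1 v) /\ f1 (act (block_operator1 A1) v) = deriv_C0 (f1 v) by case.
  split; last first.
    rewrite !pDE (component_conserved sgcT1 gcA1 dense1 f2_lin)//.
    have := shift_component_le sgcT1 gcA1 dense1 f1_lin f1_le shift u t0.
    by rewrite ge_max !le_max lexx orbT => ->.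
  apply: le_trans (driven_component sgcT1 gcA1 dense1 sgT1 gA1 pE_lin pE_le
    f1_lin f1_le shift _ K_ge0 c_ge0 T1K u t0) _; first by move=> v [].
  by rewrite ler_wpM2l ?pDE ?le_max ?lexx// !mulr_ge0// expR_ge0.
have cT2d : driven_by pE pD K c T2 cT2.
  move=> t u t0.
  have shift v : dom (block_operator2 A2) v ->
    C01 (f2 v) /\ f2 (act (block_operator2 A2) v) = deriv_C0 (f2 v) by case.
  split; last first.
    rewrite !pDE (component_conserved sgcT2 gcA2 dense2 f1_lin)//.
    have := shift_component_le sgcT2 gcA2 dense2 f2_lin f2_le shift u t0.
    by rewrite ge_max !le_max lexx/= => ->; rewrite orbT.
  apply: le_trans (driven_component sgcT2 gcA2 dense2 sgT2 gA2 pE_lin pE_le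
    f2_lin f2_le shift _ K_ge0 c_ge0 T2K u t0) _; first by move=> v [].
  by rewrite ler_wpM2l ?pDE ?le_max ?lexx ?orbT// !mulr_ge0// expR_ge0.
have stab (h : R) (n : nat) x : 0 <= h ->
    `|iter n (symmetrized_step T1 T2 h) x| <= M' * expR (n%:R * h * omega') * `|x|.
  move=> h0; case: n => [|n]; first by rewrite !mul0r expR0 mulr1 ler_peMl.
  have nh0 : 0 <= n.+1%:R * h by rewrite mulr_ge0.
  have hE : n.+1%:R * h / n.+1%:R = h by rewrite mulrAC divff ?mul1r.
  have l1 := semigroup_linear sgT1 h0; have l2 := semigroup_linear sgT2 h0.
  have prodE y : symmetrized_product T1 T2 (n.+1%:R * h) n.+1 y =
      iter n.+1 (symmetrized_step T1 T2 h) y.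
    by rewrite symmetrized_productE hE.
  rewrite -prodE; apply: le_opnorm; last exact: stable.
  move=> a y z; rewrite !prodE.
  exact: (linear_iter n.+1 (linear_symmetrized_step l1 l2)).
have [M [w [M1 w0 cstab]]] := symmetrized_stability pE_lin pD_lin pE_le pD_le pED_le
  K_ge1 c_ge0 (semigroup_linear sgT1) (semigroup_linear sgT2)
  T1K T2K cT1d cT2d M'1 omega'0 stab.
have M0 : 0 <= M by lra.
have cprodE (t : R) n u : 0 <= t -> symmetrized_product cT1 cT2 t n u =
    iter n (symmetrized_step cT1 cT2 (t / n%:R)) u.
  move=> t0; have h0 : 0 <= t / n%:R by rewrite divr_ge0.
  rewrite symmetrized_productE//; exact: semigroup_linear.
split.
  exists M, w; split=> // t n t0 n0; apply: opnorm_le => [|u].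
    by rewrite mulr_ge0// expR_ge0.
  rewrite cprodE//; have h0 : 0 <= t / n%:R by rewrite divr_ge0.
  have := cstab _ n u h0; rewrite mulrCA divff ?mulr1//.
  by rewrite pnatr_eq0 -lt0n.
move=> cA cT clA [sgcT gcA] x t t0.
under eq_fun => n do rewrite cprodE//.
have [L L0 [S1L S2L]] : exists2 L : R, 0 <= L &
    (forall (h : R) u, 0 <= h <= 1 -> `|cT1 h u| <= L * `|u|) /\
    (forall (h : R) u, 0 <= h <= 1 -> `|cT2 h u| <= L * `|u|).
  exists (2 * (K * expR c) + 1).
    by rewrite addr_ge0// !mulr_ge0// expR_ge0.
  split.
    exact: (driven_local_bound pE_le pD_le pED_le K_ge1 c_ge0 T1K cT1d).
  exact: (driven_local_bound pE_le pD_le pED_le K_ge1 c_ge0 T2K cT2d).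
apply: (product_formula (V := symmetrized_step cT1 cT2) (M := M) (w := w) _ _ _
  M0 w0 clA sgcT gcA) => //.
- by move=> h h0; apply: linear_symmetrized_step; exact: semigroup_linear.
- move=> u [B1u B2u] e e0.
  exact: (symmetrized_step_derivative gencT1 gencT2 L0 S1L S2L B1u B2u e0).
- move=> u; rewrite /symmetrized_step !(semigroup0 sgcT1) !(semigroup0 sgcT2).
  by linear_comb.
Qed.
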